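(* Let $K$ be a field, $\mathcal D$ a nonempty set, $\mathcal H^{\mathcal D}$ the Hopf algebra of planar rooted forests decorated by $\mathcal D$, and $(\mathcal A^{\mathcal D},\prec,\succ,\tilde\Delta)$ its augmentation ideal with its dendriform bialgebra structure. There is a unique pair of linear maps $\Delta_\prec,\Delta_\succ:\mathcal A^{\mathcal D}\to\mathcal A^{\mathcal D}\otimes\mathcal A^{\mathcal D}$ with $\Delta_\prec+\Delta_\succ=\tilde\Delta$, such that $(\mathcal A^{\mathcal D},\prec,\succ,\Delta_\prec,\Delta_\succ)$ is a bidendriform bialgebra and such that $\Delta_\prec(\bullet_d)=\Delta_\succ(\bullet_d)=0$ for all $d\in\mathcal D$. Hence $(\mathcal A^{\mathcal D},\prec,\succ,\Delta_\prec,\Delta_\succ)$ is a bidendriform bialgebra which induces the given Hopf algebra structure of $\mathcal H^{\mathcal D}$.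
   Context: **Dendriform notions.** A dendriform algebra is a $K$-vector space $A$ with linear maps $\prec,\succ:A\otimes A\to A$ such that for all $a,b,c$: $(a\prec b)\prec c=a\prec(b\prec c+b\succ c)$, $(a\succ b)\prec c=a\succ(b\prec c)$, $(a\prec b+a\succ b)\succ c=a\succ(b\succ c)$. One writes $ab=a\prec b+a\succ b$ (associative). A dendriform coalgebra is a $K$-vector space $C$ with $\Delta_\prec,\Delta_\succ:C\to C\otimes C$ such that, with $\tilde\Delta=\Delta_\prec+\Delta_\succ$: $(\Delta_\prec\otimes Id)\Delta_\prec=(Id\otimes\tilde\Delta)\Delta_\prec$, $(\Delta_\succ\otimes Id)\Delta_\prec=(Id\otimes\Delta_\prec)\Delta_\succ$, $(\tilde\Delta\otimes Id)\Delta_\succ=(Id\otimes\Delta_\succ)\Delta_\succ$. Notation (sums implicit): $\Delta_\prec(a)=a'_\prec\otimes a''_\prec$, $\Delta_\succ(a)=a'_\succ\otimes a''_\succ$, $\tilde\Delta(a)=a'\otimes a''$. A dendriform bialgebra is $(A,\prec,\succ,\tilde\Delta)$ with $(A,\prec,\succ)$ a dendriform algebra, $\tilde\Delta$ coassociative and $\tilde\Delta(a\prec b)=a'b'\otimes a''\prec b''+a'\otimes a''\prec b+a'b\otimes a''+b'\otimes a\prec b''+b\otimes a$, $\tilde\Delta(a\succ b)=a'b'\otimes a''\succ b''+a'\otimes a''\succ b+ab'\otimes b''+b'\otimes a\succ b''+a\otimes b$. A bidendriform bialgebra is $(A,\prec,\succ,\Delta_\prec,\Delta_\succ)$, both a dendriform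 algebra and a dendriform coalgebra, such that for all $a,b$: $\Delta_\succ(a\succ b)=a'b'_\succ\otimes a''\succ b''_\succ+a'\otimes a''\succ b+b'_\succ\otimes a\succ b''_\succ+ab'_\succ\otimes b''_\succ+a\otimes b$; $\Delta_\succ(a\prec b)=a'b'_\succ\otimes a''\prec b''_\succ+a'\otimes a''\prec b+b'_\succ\otimes a\prec b''_\succ$; $\Delta_\prec(a\succ b)=a'b'_\prec\otimes a''\succ b''_\prec+ab'_\prec\otimes b''_\prec+b'_\prec\otimes a\succ b''_\prec$; $\Delta_\prec(a\prec b)=a'b'_\prec\otimes a''\prec b''_\prec+a'b\otimes a''+b'_\prec\otimes a\prec b''_\prec+b\otimes a$. It induces the bialgebra $\overline A=A\oplus K$, with unit $1$, product $ab=a\prec b+a\succ b$ on $A$, and $\Delta(1)=1\otimes1$, $\Delta(a)=a\otimes1+1\otimes a+\tilde\Delta(a)$. **Trees.** $\mathbb T^{\mathcal D}$ is the set of planar rooted trees whose vertices are decorated by elements of $\mathcal D$; $\mathbb F^{\mathcal D}$ is the set of planar forests (finite, possibly empty, ordered sequences $t_1\cdots t_n$ of elements of $\mathbb T^{\mathcal D}$; the empty forest is $1$). $\mathcal H^{\mathcal D}$ is the free associative unital $K$-algebra on $\mathbb T^{\mathcal D}$, with basis $\mathbb F^{\mathcal D}$ and product concatenation. $\bullet_d$ is the one-vertex tree decorated by $d$; $B_d^+:\mathcal H^{\mathcal D}\to\mathcal H^{\mathcal D}$ is the linear map sending a forest $t_1\cdots t_n$ to the tree obtained by grafting $t_1,\dots,t_n$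 (in this order) on a common root decorated by $d$. An admissible cut $c$ of a tree $t$ is a nonempty set of edges such that every path from the root to a leaf meets at most one of them; $R^c(t)$ is the component of the root after cutting, $P^c(t)$ the planar forest of the other components (in the same order). One adds the empty cut ($P=1,R=t$) and the total cut ($P=t,R=1$), giving $\mathcal Adm_*(t)$. For $F=t_1\cdots t_n$, $\mathcal Adm_*(F)$ is the set of tuples $c=(c_1,\dots,c_n)$ with $c_i\in\mathcal Adm_*(t_i)$, $P^c(F)=P^{c_1}(t_1)\cdots P^{c_n}(t_n)$, $R^c(F)=R^{c_1}(t_1)\cdots R^{c_n}(t_n)$. The coproduct is $\Delta(F)=\sum_{c\in\mathcal Adm_*(F)}P^c(F)\otimes R^c(F)$, the counit $\varepsilon(F)=\delta_{F,1}$. $\mathcal A^{\mathcal D}=\ker\varepsilon$ is spanned by the nonempty forests; $\tilde\Delta(x)=\Delta(x)-x\otimes1-1\otimes x$ on $\mathcal A^{\mathcal D}$. Known facts fixing the dendriform structure of $\mathcal A^{\mathcal D}$: there is a unique dendriform algebra structure $(\prec,\succ)$ on $\mathcal A^{\mathcal D}$ with $x\prec y+x\succ y=xy$ (concatenation) and $\bullet_d\prec x=B_d^+(x)$ for all $d\in\mathcal D$, $x\in\mathcal A^{\mathcal D}$; with it $\mathcal A^{\mathcal D}$ is the free dendriform algebra on $\{\bullet_d\}_{d\in\mathcal D}$, and $(\mathcal A^{\mathcal D},\prec,\succ,\tilde\Delta)$ is a dendriform bialgebra. *)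

(* Defs.v *)
From HB Require Import structures.
From mathcomp Require Import all_boot all_order all_algebra.
From mathcomp Require Import sesquilinear ring_quotient generic_quotient.
From mathcomp Require Import finmap boolp.
From mathcomp.multinomials Require Import monalg.

Set Implicit Arguments.
Unset Strict Implicit.
Unset Printing Implicit Defensive.

Import GRing.Theory.
Local Open Scope ring_scope.

Reserved Notation "V \ox W" (at level 40, left associativity).
Reserved Notation "\sw_ ( v , w <- t ) E"
  (at level 36, E at level 36, v name, w name, t at level 100,
   format "\sw_ ( v ,  w  <-  t )  E").

Lemma malgZU (R : nzRingType) (X : choiceType) (c a : R) (k : X) :
  c *: << a *g k >> = << c * a *g k >> :> {malg R[X]}.
Proof. by apply/malgP => j; rewrite mcoeffZ !mcoeffU mulrnAr. Qed.

Section LinearExtension.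
Variables (K : fieldType) (X : choiceType) (V : lmodType K).

(* The linear extension to the free vector space {malg K[X]} of a map defined
   on its basis X. *)
Definition linext (f : X -> V) (x : {malg K[X]}) : V :=
  \sum_(k <- msupp x) x@_k *: f k.

Lemma linextEw f (d : {fset X}) x : (msupp x `<=` d)%fset ->
  linext f x = \sum_(k <- d) x@_k *: f k.
Proof.
move=> le; rewrite /linext (big_fset_incl _ le) //=.
by move=> k _ kx; rewrite mcoeff_outdom // scale0r.
Qed.

Lemma linext_is_linear f : linear (linext f).
Proof.
move=> c x y; pose d := (msupp x `|` msupp y `|` msupp (c *: x + y))%fset.
rewrite !(@linextEw f d) ?fsubsetUr //.
- rewrite scaler_sumr -big_split /=; apply: eq_bigr => k _.
  by rewrite mcoeffD mcoeffZ scalerDl scalerA.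
- exact: fsubset_trans (fsubsetUr _ _) (fsubsetUl _ _).
- exact: fsubset_trans (fsubsetUl _ _) (fsubsetUl _ _).
Qed.

HB.instance Definition _ f :=
  GRing.isLinear.Build K {malg K[X]} V *:%R (linext f) (linext_is_linear f).

Lemma linextU f k : linext f << k >> = f k.
Proof.
rewrite (@linextEw f [fset k]%fset) ?msuppU_le // big_seq_fset1.
by rewrite mcoeffUU scale1r.
Qed.

Lemma linext_unique (f : X -> V) (g : {linear {malg K[X]} -> V}) :
  (forall k, g << k >> = f k) -> g =1 linext f.
Proof.
move=> gf x; rewrite [x in LHS]monalgE linear_sum /=; apply: eq_bigr => k _.
rewrite -gf -linearZ; congr (g _).
by rewrite malgZU mulr1.
Qed.

End LinearExtension.

Section Tensor.
Variables (K : fieldType) (V W : lmodType K).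

Local Notation free := {malg K[(V * W)%type]}.
Local Notation gen v w := (<< (v, w) >> : free).

Inductive tensor_null : free -> Prop :=
| Null0 : tensor_null 0
| NullP c x y : tensor_null x -> tensor_null y -> tensor_null (c *: x + y)
| NullDl v1 v2 w : tensor_null (gen (v1 + v2) w - (gen v1 w + gen v2 w))
| NullDr v w1 w2 : tensor_null (gen v (w1 + w2) - (gen v w1 + gen v w2))
| NullZl c v w : tensor_null (gen (c *: v) w - c *: gen v w)
| NullZr c v w : tensor_null (gen v (c *: w) - c *: gen v w).

Definition tensor_rel : {pred free} := fun x => `[< tensor_null x >].

Lemma tensor_relP x : reflect (tensor_null x) (x \in tensor_rel).
Proof. exact: asboolP. Qed.

Lemma tensor_rel_submod : submod_closed tensor_rel.
Proof.
split=> [|c x y /tensor_relP nx /tensor_relP ny].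
  by apply/tensor_relP; apply: Null0.
by apply/tensor_relP; apply: NullP.
Qed.

HB.instance Definition _ :=
  GRing.isSubmodClosed.Build K free tensor_rel tensor_rel_submod.

Definition tensor : Type := Quotient.quot tensor_rel.
HB.instance Definition _ := GRing.Zmodule.on tensor.
HB.instance Definition _ := EqQuotient.on tensor.

Definition tpi (x : free) : tensor := \pi_(Quotient.quot tensor_rel)%qT x.
Definition trepr (t : tensor) : free := repr (t : Quotient.quot tensor_rel).

Lemma treprK : cancel trepr tpi.
Proof. exact: reprK. Qed.

Lemma tpi_eqP x y : tpi x = tpi y <-> tensor_null (x - y).
Proof.
split=> [/eqP|/tensor_relP n].
  by rewrite -Quotient.idealrBE => /tensor_relP.
by apply/eqP; rewrite -Quotient.idealrBE.
Qed.

Lemma tpi_is_zmod_morphism : zmod_morphism tpi.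
Proof. by move=> x y; rewrite /tpi !piE. Qed.

HB.instance Definition _ :=
  GRing.isZmodMorphism.Build free tensor tpi tpi_is_zmod_morphism.

Definition tscale (c : K) (t : tensor) : tensor := tpi (c *: trepr t).

Lemma tpi_scale c x : tpi (c *: x) = tscale c (tpi x).
Proof.
apply/tpi_eqP; rewrite -scalerBr -[_ *: _]addr0.
by apply: NullP; [apply/tpi_eqP; rewrite treprK | exact: Null0].
Qed.

Fact tscaleA a b t : tscale a (tscale b t) = tscale (a * b) t.
Proof. by rewrite -[t]treprK -!tpi_scale scalerA. Qed.
Fact tscale1 : left_id 1 tscale.
Proof. by move=> t; rewrite -[t]treprK -!tpi_scale scale1r. Qed.
Fact tscaleDr : right_distributive tscale +%R.
Proof.
move=> c s t; rewrite -[s]treprK -[t]treprK -raddfD -!tpi_scale.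
by rewrite scalerDr raddfD.
Qed.
Fact tscaleDl t : {morph tscale^~ t : a b / a + b}.
Proof. by move=> a b; rewrite -[t]treprK -!tpi_scale scalerDl raddfD. Qed.

HB.instance Definition _ := GRing.Zmodule_isLmodule.Build K tensor
  tscaleA tscale1 tscaleDr tscaleDl.

Fact tpi_is_scalable : scalable tpi.
Proof. exact: tpi_scale. Qed.

HB.instance Definition _ :=
  GRing.isScalable.Build K free tensor *:%R tpi tpi_is_scalable.

Definition pure (v : V) (w : W) : tensor := tpi (gen v w).

Fact pure_is_bilinear : bilinear_for *:%R *:%R pure.
Proof.
have E (x a b z : free) : a - (b + z) = 1 *: (a - (x + z)) + (x - b).
  by rewrite scale1r !opprD !addrA (addrAC a (- x)) subrK (addrAC a).
split=> [w c v1 v2|v c w1 w2]; rewrite /pure -linearZ -raddfD.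
  apply/tpi_eqP; rewrite (E (gen (c *: v1) w)).
  by apply: NullP; [exact: NullDl | exact: NullZl].
apply/tpi_eqP; rewrite (E (gen v (c *: w1))).
by apply: NullP; [exact: NullDr | exact: NullZr].
Qed.

HB.instance Definition _ :=
  bilinear_isBilinear.Build K V W tensor *:%R *:%R pure pure_is_bilinear.

(* The map v \ox w |-> f v w.  It is only meaningful for a bilinear f; for such
   an f it does not depend on the chosen representative (see tliftE). *)
Definition tlift (U : lmodType K) (f : V -> W -> U) (t : tensor) : U :=
  linext (fun p => f p.1 p.2) (trepr t).

Lemma tensorE (t : tensor) :
  t = \sum_(p <- msupp (trepr t)) (trepr t)@_p *: pure p.1 p.2.
Proof.
rewrite -[t in LHS]treprK [trepr t in LHS]monalgE raddf_sum /=.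
apply: eq_bigr => -[v w] _; rewrite -linearZ; congr (tpi _).
by rewrite malgZU mulr1.
Qed.

Section Lift.
Variables (U : lmodType K) (f : V -> W -> U).
Hypothesis fP : bilinear_for *:%R *:%R f.

Let fh := linext (fun p : (V * W)%type => f p.1 p.2).

Let fhP c x y : fh (c *: x + y) = c *: fh x + fh y.
Proof. exact: linext_is_linear. Qed.

Let fhU v w : fh (gen v w) = f v w.
Proof. exact: linextU. Qed.

Let fh_null x : tensor_null x -> fh x = 0.
Proof.
have fh0 : fh 0 = 0 by have := fhP (-1) 0 0; rewrite !scaleN1r !addNr.
have fhB y z : fh (y - z) = fh y - fh z.
  by have := fhP (-1) z y; rewrite !scaleN1r addrC => ->; rewrite addrC.
have fhD y z : fh (y + z) = fh y + fh z by have := fhP 1 y z; rewrite !scale1r.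
have fhZ c y : fh (c *: y) = c *: fh y.
  by have := fhP c y 0; rewrite fh0 !addr0.
elim=> [|c y z _ IHy _ IHz|v1 v2 w|v w1 w2|c v w|c v w].
- exact: fh0.
- by rewrite fhP IHy IHz scaler0 addr0.
- have := fP.1 w 1 v1 v2; rewrite /= !scale1r => E.
  by rewrite fhB fhD !fhU E subrr.
- have := fP.2 v 1 w1 w2; rewrite /= !scale1r => E.
  by rewrite fhB fhD !fhU E subrr.
- have f0 : f 0 w = 0 by have := fP.1 w (-1) v v; rewrite /= !scaleN1r !addNr.
  have := fP.1 w c v 0; rewrite /= f0 !addr0 => E.
  by rewrite fhB fhZ !fhU E subrr.
- have f0 : f v 0 = 0 by have := fP.2 v (-1) w w; rewrite /= !scaleN1r !addNr.
  have := fP.2 v c w 0; rewrite /= f0 !addr0 => E.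
  by rewrite fhB fhZ !fhU E subrr.
Qed.

Let tlift_pi x : tlift f (tpi x) = fh x.
Proof.
rewrite -[x](subrK (trepr (tpi x))) -[_ - _]scale1r fhP fh_null ?scaler0 ?add0r.
  by rewrite scale1r subrK.
by apply/tpi_eqP; rewrite treprK.
Qed.

Lemma tliftE v w : tlift f (pure v w) = f v w.
Proof. by rewrite tlift_pi /fh linextU. Qed.

Lemma tlift_is_linear : linear (tlift f).
Proof.
move=> c s t; rewrite -[s]treprK -[t]treprK -linearZ -raddfD !tlift_pi.
by rewrite /fh linearP.
Qed.

Lemma tlift_unique (g : {linear tensor -> U}) :
  (forall v w, g (pure v w) = f v w) -> g =1 tlift f.
Proof.
move=> gf t; rewrite [t in LHS]tensorE linear_sum; apply: eq_bigr => p _.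
by rewrite linearZ gf.
Qed.

End Lift.
End Tensor.

Notation "V \ox W" := (tensor V%type W%type) : type_scope.
Notation "v \ox w" := (pure v w) : ring_scope.

(* Sweedler's notation: replace every v \ox w in t by E, extended linearly. *)
Notation "\sw_ ( v , w <- t ) E" := (tlift (fun v w => E) t) : ring_scope.

Section TensorMaps.
Variable K : fieldType.

Definition tmap (U V U' V' : lmodType K) (f : U -> U') (g : V -> V')
  (t : U \ox V) : U' \ox V' := \sw_(u, v <- t) (f u \ox g v).

Definition tassoc (U V W : lmodType K) (t : (U \ox V) \ox W) :
    U \ox (V \ox W) :=
  \sw_(s, w <- t) \sw_(u, v <- s) (u \ox (v \ox w)).

End TensorMaps.

Section Dendriform.
Variables (K : fieldType) (A : lmodType K).

Record dendriform_algebra (prec succ : A -> A -> A) : Prop :=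
  DendriformAlgebra {
  dendri_bilinear_prec : bilinear_for *:%R *:%R prec;
  dendri_bilinear_succ : bilinear_for *:%R *:%R succ;
  dendri_prec_prec a b c : prec (prec a b) c = prec a (prec b c + succ b c);
  dendri_succ_prec a b c : prec (succ a b) c = succ a (prec b c);
  dendri_succ_succ a b c : succ (prec a b + succ a b) c = succ a (succ b c)
}.

Record dendriform_coalgebra (Dp Ds : A -> A \ox A) : Prop :=
  DendriformCoalgebra {
  codendri_linear_prec : linear Dp;
  codendri_linear_succ : linear Ds;
  codendri_prec_prec a :
    tassoc (tmap Dp id (Dp a)) = tmap id (fun x => Dp x + Ds x) (Dp a);
  codendri_succ_prec a : tassoc (tmap Ds id (Dp a)) = tmap id Dp (Ds a);
  codendri_succ_succ a :
    tassoc (tmap (fun x => Dp x + Ds x) id (Ds a)) = tmap id Ds (Ds a)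
}.

Record bidendriform_bialgebra (prec succ : A -> A -> A) (Dp Ds : A -> A \ox A)
    : Prop := BidendriformBialgebra {
  bidendri_algebra : dendriform_algebra prec succ;
  bidendri_coalgebra : dendriform_coalgebra Dp Ds;
  bidendri_succ_succ a b :
    let m x y := prec x y + succ x y in
    let Dt x := Dp x + Ds x in
    Ds (succ a b) =
        (\sw_(a1, a2 <- Dt a) \sw_(b1, b2 <- Ds b) (m a1 b1 \ox succ a2 b2))
      + (\sw_(a1, a2 <- Dt a) (a1 \ox succ a2 b))
      + (\sw_(b1, b2 <- Ds b) (b1 \ox succ a b2))
      + (\sw_(b1, b2 <- Ds b) (m a b1 \ox b2))
      + a \ox b;
  bidendri_succ_prec a b :
    let m x y := prec x y + succ x y in
    let Dt x := Dp x + Ds x in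
    Ds (prec a b) =
        (\sw_(a1, a2 <- Dt a) \sw_(b1, b2 <- Ds b) (m a1 b1 \ox prec a2 b2))
      + (\sw_(a1, a2 <- Dt a) (a1 \ox prec a2 b))
      + (\sw_(b1, b2 <- Ds b) (b1 \ox prec a b2));
  bidendri_prec_succ a b :
    let m x y := prec x y + succ x y in
    let Dt x := Dp x + Ds x in
    Dp (succ a b) =
        (\sw_(a1, a2 <- Dt a) \sw_(b1, b2 <- Dp b) (m a1 b1 \ox succ a2 b2))
      + (\sw_(b1, b2 <- Dp b) (m a b1 \ox b2))
      + (\sw_(b1, b2 <- Dp b) (b1 \ox succ a b2));
  bidendri_prec_prec a b :
    let m x y := prec x y + succ x y in
    let Dt x := Dp x + Ds x in
    Dp (prec a b) =
        (\sw_(a1, a2 <- Dt a) \sw_(b1, b2 <- Dp b) (m a1 b1 \ox prec a2 b2))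
      + (\sw_(a1, a2 <- Dt a) (m a1 b \ox a2))
      + (\sw_(b1, b2 <- Dp b) (b1 \ox prec a b2))
      + b \ox a
}.

(* The bialgebra A (+) K induced by a bidendriform bialgebra. *)
Definition unitization : lmodType K := (A * K^o)%type.

Variables (prec succ : A -> A -> A) (Dp Ds : A -> A \ox A).

Definition uincl (a : A) : unitization := (a, 0).

Definition uone : unitization := (0, 1).

Definition umul (x y : unitization) : unitization :=
  (prec x.1 y.1 + succ x.1 y.1 + (y.2 : K) *: x.1 + (x.2 : K) *: y.1,
   x.2 * y.2).

Definition ucoprod (x : unitization) : unitization \ox unitization :=
  (x.2 : K) *: (uone \ox uone)
  + (uincl x.1 \ox uone + uone \ox uincl x.1
     + tmap uincl uincl (Dp x.1 + Ds x.1)).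

Definition ucounit (x : unitization) : K := x.2.

End Dendriform.

Inductive ptree (D : Type) : Type := PNode of D & seq (ptree D).

Section Trees.
Variable D : Type.
Implicit Types (t : ptree D) (F : seq (ptree D)).

Lemma ptree_ind' (P : ptree D -> Prop) :
  (forall d F, foldr (fun t => and (P t)) True F -> P (PNode d F)) ->
  forall t, P t.
Proof.
move=> H; fix IH 1 => -[d F]; apply: H.
by elim: F => [|t F IHF]; split.
Qed.

Fixpoint ptree_enc t : GenTree.tree D :=
  let: PNode d F := t in
  GenTree.Node 0 (GenTree.Leaf d :: map ptree_enc F).

Fixpoint ptree_dec (g : GenTree.tree D) : option (ptree D) :=
  if g is GenTree.Node _ (GenTree.Leaf d :: gs)
  then Some (PNode d (pmap ptree_dec gs)) else None.

Lemma ptree_encK : pcancel ptree_enc ptree_dec.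
Proof.
elim/ptree_ind' => d F IH /=; congr (Some (PNode d _)).
by elim: F IH => [//|t F IHF] /= [-> /IHF ->].
Qed.

Definition children t := let: PNode _ F := t in F.

(* A vertex is the list of the positions of the children to follow from the
   root.  They are listed in preorder, the root coming first. *)
Fixpoint vertices t : seq (seq nat) :=
  let: PNode _ F := t in
  [::] :: flatten [seq [seq p.1 :: v | v <- p.2]
                  | p <- zip (iota 0 (size F)) (map vertices F)].

Fixpoint subtree t (v : seq nat) : ptree D :=
  if v is i :: v' then subtree (nth t (children t) i) v' else t.

Definition leaves t := [seq v <- vertices t | nilp (children (subtree t v))].

(* An edge is identified with its vertex farther from the root. *)
Definition edges t : seq (seq nat) := behead (vertices t).

(* The nonempty prefixes of the vertex l are the edges on the path from the
   root to l. *)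
Definition admissible t (c : seq (seq nat)) : bool :=
  (c != [::]) && all (fun l => count (fun e => prefix e l) c <= 1)%N (leaves t).

Fixpoint subseqs (T : Type) (s : seq T) : seq (seq T) :=
  if s is x :: s' then [seq x :: u | u <- subseqs s'] ++ subseqs s'
  else [:: [::]].

(* A set of edges of t is a subsequence of edges t; None stands for the total
   cut and Some [::] for the empty cut. *)
Definition cut : Type := option (seq (seq nat)).

Definition adm_cuts t : seq cut :=
  [:: None, Some [::]
    & [seq Some c | c <- [seq c <- subseqs (edges t) | admissible t c]]].

(* component c t v is the connected component of the root of t after removing
   the edges of c, t being the subtree at the vertex v of the tree where c is
   taken. *)
Fixpoint component (c : seq (seq nat)) t (v : seq nat) : ptree D :=
  let: PNode d F := t in
  PNode d [seq p.2 (rcons v p.1)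
          | p <- [seq p <- zip (iota 0 (size F)) (map (component c) F)
                 | rcons v p.1 \notin c]].

Definition cut_P t (c : cut) : seq (ptree D) :=
  if c is Some c' then [seq component c' (subtree t e) e | e <- c'] else [:: t].

Definition cut_R t (c : cut) : seq (ptree D) :=
  if c is Some c' then [:: component c' t [::]] else [::].

Fixpoint adm_cuts_forest F : seq (seq cut) :=
  if F is t :: F' then [seq c :: cs | c <- adm_cuts t, cs <- adm_cuts_forest F']
  else [:: [::]].

Definition forest_P F (cs : seq cut) : seq (ptree D) :=
  flatten [seq cut_P p.1 p.2 | p <- zip F cs].

Definition forest_R F (cs : seq cut) : seq (ptree D) :=
  flatten [seq cut_R p.1 p.2 | p <- zip F cs].

End Trees.

HB.instance Definition _ (D : choiceType) :=
  Choice.copy (ptree D) (pcan_type (@ptree_encK D)).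

(* The free associative algebra on the planar trees: {fmonom I} is the free
   monoid on I, so its product is the concatenation of forests. *)
Notation forest_algebra K D := {malg K[{fmonom (ptree D)}]}.

Section HopfAlgebra.
Variables (K : fieldType) (D : choiceType).

Local Notation HD := (forest_algebra K D).

Definition forest (F : seq (ptree D)) : HD := << FMonom F >>.

Definition Bplus (d : D) : HD -> HD :=
  linext (fun F : {fmonom (ptree D)} => forest [:: PNode d F]).

Definition coprod : HD -> HD \ox HD :=
  linext (fun F : {fmonom (ptree D)} =>
    \sum_(c <- adm_cuts_forest F)
      (forest (forest_P F c) \ox forest (forest_R F c))).

Definition counit (x : HD) : K := x@_(mone : {fmonom (ptree D)}).

Definition counit_ker : {pred HD} := fun x => counit x == 0.

Lemma counit_ker_submod : submod_closed counit_ker.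
Proof.
split=> [|c x y]; rewrite !unfold_in /counit ?mcoeff0 //.
by rewrite mcoeffD mcoeffZ => /eqP-> /eqP->; rewrite mulr0 addr0.
Qed.

HB.instance Definition _ :=
  GRing.isSubmodClosed.Build K HD counit_ker counit_ker_submod.

Record AD := MkAD { adval :> HD; _ : adval \in counit_ker }.
HB.instance Definition _ := [isSub for adval].
HB.instance Definition _ := [Choice of AD by <:].
HB.instance Definition _ := [SubChoice_isSubLmodule of AD by <:].

Lemma counit_forest F : counit (forest F) = (nilp F)%:R.
Proof.
rewrite /counit /forest mcoeffU; congr (_%:R); congr nat_of_bool.
by rewrite fmP fm1; case: F.
Qed.

Lemma Bplus_in_ker d x : Bplus d x \in counit_ker.
Proof.
apply: rpred_sum => k _; apply: rpredZ.
by rewrite unfold_in counit_forest.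
Qed.

Definition bullet (d : D) : AD := MkAD (Bplus_in_ker d 1).

Lemma bulletE d : adval (bullet d) = forest [:: PNode d [::]].
Proof. by rewrite /= /Bplus linextU fm1. Qed.

Record tree_dendriform (prec succ : AD -> AD -> AD) : Prop := TreeDendriform {
  tree_dendri_algebra : dendriform_algebra prec succ;
  tree_dendri_mul x y : adval (prec x y + succ x y) = adval x * adval y;
  tree_dendri_bullet d x : adval (prec (bullet d) x) = Bplus d (adval x)
}.

(* The sum Dp + Ds is the reduced coproduct of the forest algebra; the equation
   is stated after applying the inclusion of AD \ox AD into HD \ox HD. *)
Definition splits_reduced_coprod (Dp Ds : AD -> AD \ox AD) : Prop :=
  forall x, tmap adval adval (Dp x + Ds x)
            = coprod (adval x) - adval x \ox 1 - 1 \ox adval x.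

Record tree_bidendriform (prec succ : AD -> AD -> AD)
    (Dp Ds : AD -> AD \ox AD) : Prop := TreeBidendriform {
  tree_bidendri_split : splits_reduced_coprod Dp Ds;
  tree_bidendri_bialgebra : bidendriform_bialgebra prec succ Dp Ds;
  tree_bidendri_bullet_prec d : Dp (bullet d) = 0;
  tree_bidendri_bullet_succ d : Ds (bullet d) = 0
}.

(* The identification of K (+) AD with the forest algebra. *)
Definition of_unitization (x : unitization AD) : HD :=
  adval x.1 + (x.2 : K) *: 1.

Record induces_forest_bialgebra (prec succ : AD -> AD -> AD)
    (Dp Ds : AD -> AD \ox AD) : Prop := InducesForestBialgebra {
  ind_bijective : bijective of_unitization;
  ind_linear : linear of_unitization;
  ind_one : of_unitization (uone AD) = 1;
  ind_mul x y :
    of_unitization (umul prec succ x y) = of_unitization x * of_unitization y;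
  ind_coprod x :
    tmap of_unitization of_unitization (ucoprod Dp Ds x)
    = coprod (of_unitization x);
  ind_counit x : counit (of_unitization x) = ucounit x
}.

End HopfAlgebra.

Section DendriformStep.
Variables (K : fieldType) (L : lalgType K).
Hypothesis scaleMr : forall c (x y : L), x * (c *: y) = c *: (x * y).

Lemma dendri_linear_step (B : L -> L) c (t g f x y p q : L) : linear B ->
  t * (c *: p + q) + B (g * (f * (c *: x + y) - (c *: p + q)))
  = c *: (t * p + B (g * (f * x - p))) + (t * q + B (g * (f * y - q))).
Proof.
move=> BP; have -> : f * (c *: x + y) - (c *: p + q)
                   = c *: (f * x - p) + (f * y - q).
  by rewrite mulrDr scaleMr opprD addrACA scalerBr.
by rewrite [g * _]mulrDr scaleMr BP mulrDr scaleMr addrACA scalerDr.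
Qed.

Lemma dendri_linearl_step (P : L -> L -> L) (B : L -> L) (t g z : L) :
  linear B -> linear (P^~ z) ->
  linear (fun x => t * P x z + B (g * (x * z - P x z))).
Proof.
move=> BP PP c x y /=; have /= -> := PP c x y.
have := dendri_linear_step c t g 1 (x * z) (y * z) (P x z) (P y z) BP.
by rewrite !mul1r => <-; rewrite mulrDl -scalerAl.
Qed.

Lemma scaler_linear_step (a c : K) (u v : L) :
  a *: (c *: u + v) = c *: (a *: u) + a *: v.
Proof. by rewrite scalerDr !scalerA mulrC. Qed.

Lemma linear_mulr_comp (B : L -> L) (g : L) : linear B ->
  linear (fun x => B (g * x)).
Proof. by move=> BP c x y; rewrite mulrDr scaleMr BP. Qed.

Lemma linear_mull_comp (B : L -> L) (z : L) : linear B ->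
  linear (fun x => B (x * z)).
Proof. by move=> BP c x y; rewrite mulrDl -scalerAl BP. Qed.

Lemma linear_compl (f g : L -> L) : linear f -> linear g ->
  linear (fun x => f (g x)).
Proof. by move=> fL gL c x y; rewrite gL fL. Qed.

Lemma linear_succl_step (P : L -> L -> L) (y : L) :
  linear (P^~ y) -> linear (fun x => x * y - P x y).
Proof.
move=> PP c u v /=; have /= -> := PP c u v.
by rewrite mulrDl -scalerAl opprD addrACA -scalerBr.
Qed.

Lemma linear_succr_step (P : L -> L -> L) (x : L) :
  linear (P x) -> linear (fun y => x * y - P x y).
Proof.
by move=> PP c u v /=; rewrite PP mulrDr scaleMr opprD addrACA -scalerBr.
Qed.

Lemma linear_mul_step (P : L -> L -> L) (y z : L) :
  (forall z, linear (P^~ z)) ->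
  linear (fun f => f * P y z + P f (y * z - P y z)).
Proof.
move=> PP c f g /=; have /= -> := PP (y * z - P y z) c f g.
by rewrite mulrDl -scalerAl addrACA -scalerDr.
Qed.

Variables (P : L -> L -> L) (t : L) (b : L -> L).
Hypothesis bD : {morph b : x y / x + y}.
Hypothesis PDl : forall z, {morph P^~ z : x y / x + y}.
Hypothesis Pt : forall w z, P (t * w) z = t * P w z + b (w * z - P w z).
Hypothesis Pb : forall w z, P (b w) z = b (w * z).

Lemma dendri_assoc_step f y z :
  P (P f y) z = P f (y * z) -> P (P (t * f) y) z = P (t * f) (y * z).
Proof.
move=> IH; rewrite [P _ y]Pt PDl [P _ (y * z)]Pt Pt Pb IH -addrA -bD.
by rewrite mulrBl addrCA addrAC subrr add0r mulrA.
Qed.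

Lemma dendri_mul_step f y z :
  P (f * y) z = f * P y z + P f (y * z - P y z) ->
  P (t * f * y) z = t * f * P y z + P (t * f) (y * z - P y z).
Proof.
move=> IH; rewrite -mulrA Pt IH Pt mulrDr !mulrA -addrA; congr (_ + (_ + b _)).
by rewrite opprD mulrBr !addrA mulrA.
Qed.

Lemma dendri_succ_prec_step x y z :
  (forall u v, P x (u - v) = P x u - P x v) ->
  (forall u v, P (u - v) z = P u z - P v z) ->
  P (P x y) z = P x (y * z) ->
  P (x * y) z = x * P y z + P x (y * z - P y z) ->
  P (x * y - P x y) z = x * P y z - P x (P y z).
Proof. by move=> Br Bl E1 E2; rewrite Bl E1 E2 Br addrA addrAC addrK. Qed.

Lemma dendri_succ_succ_step x y z :
  P (x * y) z = x * P y z + P x (y * z - P y z) ->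
  x * y * z - P (x * y) z = x * (y * z - P y z) - P x (y * z - P y z).
Proof. by move=> ->; rewrite mulrBr mulrA opprD addrA. Qed.

End DendriformStep.

Section TreeDendriformExists.
Variables (K : fieldType) (D : choiceType).
Local Notation HD := (forest_algebra K D).
Local Notation AD := (AD K D).

(* The dendriform axioms force, for t = B_d^+(G),
     t F < y = t (F < y) + B_d^+(G (F > y)),
   with the conventions 1 < y = 0 and 1 > y = y. *)
Fixpoint fprec (F : seq (ptree D)) (y : HD) : HD :=
  if F is t :: F' then
    let: PNode d G := t in
    forest K [:: t] * fprec F' y
    + Bplus d (forest K G * (forest K F' * y - fprec F' y))
  else 0.

Definition hprec (x y : HD) : HD :=
  linext (fun F : {fmonom (ptree D)} => fprec F y) x.

Definition hsucc (x y : HD) : HD := x * y - hprec x y.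

Let counitM (x y : HD) : counit (x * y) = counit x * counit y.
Proof. exact: (mcoeff1g_is_multiplicative _ _).1. Qed.

Lemma fprec_in_ker F y : fprec F y \in @counit_ker K D.
Proof.
elim: F => [|[d G] F IH] /=; first exact: rpred0.
apply: rpredD; last exact: Bplus_in_ker.
by rewrite unfold_in counitM counit_forest mul0r.
Qed.

Lemma hprec_in_ker x y : hprec x y \in @counit_ker K D.
Proof. by apply: rpred_sum => k _; apply/rpredZ/fprec_in_ker. Qed.

Lemma hsucc_in_ker x (y : AD) : hsucc x (adval y) \in @counit_ker K D.
Proof.
apply: rpredB; last exact: hprec_in_ker.
by case: y => y /= /eqP y0; rewrite unfold_in counitM y0 mulr0.
Qed.

Definition aprec (x y : AD) : AD := MkAD (hprec_in_ker (adval x) (adval y)).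
Definition asucc (x y : AD) : AD := MkAD (hsucc_in_ker (adval x) y).

Let forestM F G : forest K (F ++ G) = forest K F * forest K G :> HD.
Proof.
rewrite /forest [RHS]malgM_def fgmulUU mulr1; congr (<< _ >>).
by apply/eqP; rewrite fmP fmM.
Qed.

Let forest1 : forest K [::] = 1 :> HD.
Proof. by rewrite /forest -fmoneE. Qed.

Let BplusP d c (x y : HD) : Bplus d (c *: x + y) = c *: Bplus d x + Bplus d y.
Proof. exact: linext_is_linear. Qed.

Let malgZr (x y : HD) c : x * (c *: y) = c *: (x * y).
Proof.
rewrite (malgMEw (fsubset_refl _) (msuppZ_le c y)) malgME scaler_sumr.
apply: eq_bigr => k _; rewrite scaler_sumr; apply: eq_bigr => l _.
by rewrite malgZU mcoeffZ mulrCA.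
Qed.

Let BplusL d : linear (@Bplus K D d).
Proof. exact: linext_is_linear. Qed.

Let fprecP F c x y : fprec F (c *: x + y) = c *: fprec F x + fprec F y.
Proof.
elim: F => [|[d G] F IH] /=; first by rewrite scaler0 addr0.
rewrite IH.
exact: (dendri_linear_step (fun c x y => malgZr x y c)
  _ _ _ _ _ _ _ _ (BplusL d)).
Qed.

Lemma hprec_linearl y : linear (hprec^~ y).
Proof. by move=> c x x'; exact: linext_is_linear. Qed.

Lemma hprec_linearr x : linear (hprec x).
Proof.
move=> c y y'; rewrite /hprec /linext scaler_sumr -big_split /=.
by apply: eq_bigr => F _; rewrite fprecP scaler_linear_step.
Qed.

Let hprecDl z : {morph hprec^~ z : x y / x + y}.
Proof. by move=> x y; have := hprec_linearl z 1 x y; rewrite !scale1r. Qed.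

Let hprecDr x : {morph hprec x : y z / y + z}.
Proof. by move=> y z; have := hprec_linearr x 1 y z; rewrite !scale1r. Qed.

Let hprecF F y : hprec (forest K F) y = fprec F y.
Proof. exact: linextU. Qed.

Let linear_ext (f g : HD -> HD) : linear f -> linear g ->
  (forall F, f (forest K F) = g (forest K F)) -> f =1 g.
Proof.
move=> fL gL fg x.
pose f' : {linear HD -> HD} := HB.pack f (GRing.isLinear.Build _ _ _ _ f fL).
pose g' : {linear HD -> HD} := HB.pack g (GRing.isLinear.Build _ _ _ _ g gL).
have fgk k : f << k >> = g << k >> by case: k => F; exact: fg.
transitivity (linext (fun k => g << k >>) x).
  exact: (linext_unique (g := f')).
by symmetry; apply: (linext_unique (g := g')).
Qed.

Let scaleMr c (x y : HD) : x * (c *: y) = c *: (x * y) := malgZr x y c.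

Let hprec_cons d G (x y : HD) :
  hprec (forest K [:: PNode d G] * x) y
  = forest K [:: PNode d G] * hprec x y
    + Bplus d (forest K G * (x * y - hprec x y)).
Proof.
move: x; apply: linear_ext.
- exact: (linear_mulr_comp scaleMr _ (hprec_linearl y)).
- exact: (dendri_linearl_step scaleMr _ _ (BplusL d) (hprec_linearl y)).
- by move=> F; rewrite -forestM !hprecF.
Qed.

Let BplusF d (F : seq (ptree D)) :
  Bplus d (forest K F) = forest K [:: PNode d F].
Proof. by rewrite /Bplus linextU. Qed.

Let hprec_Bplus d (x y : HD) : hprec (Bplus d x) y = Bplus d (x * y).
Proof.
move: x; apply: linear_ext.
- exact: (linear_compl (hprec_linearl y) (BplusL d)).
- exact: (linear_mull_comp _ (BplusL d)).
- move=> F; rewrite BplusF hprecF /= forest1 mul1r subr0 mulr0 add0r //.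
Qed.

Let bD d G : {morph (fun x : HD => Bplus d (forest K G * x)) : x y / x + y}.
Proof.
by move=> x y; have := linear_mulr_comp scaleMr (forest K G) (BplusL d) 1 x y;
  rewrite !scale1r.
Qed.

Let bP d G (w z : HD) :
  hprec (Bplus d (forest K G * w)) z = Bplus d (forest K G * (w * z)).
Proof. by rewrite hprec_Bplus mulrA. Qed.

Let hprec1 y : hprec (forest K ([::] : seq (ptree D))) y = 0.
Proof. exact: hprecF. Qed.

Lemma hprec_prec x y z : hprec (hprec x y) z = hprec x (y * z).
Proof.
move: x; apply: linear_ext.
- exact: (linear_compl (hprec_linearl z) (hprec_linearl y)).
- exact: hprec_linearl.
elim=> [|[d G] F IH]; first by rewrite !hprec1 /hprec raddf0.
rewrite -cat1s forestM.
exact: (dendri_assoc_step (b := fun x => Bplus d (forest K G * x)) (@bD d G)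
  hprecDl (hprec_cons d G) (bP d G) IH).
Qed.

Lemma hprec_mul x y z :
  hprec (x * y) z = x * hprec y z + hprec x (y * z - hprec y z).
Proof.
move: x; apply: linear_ext.
- exact: (linear_mull_comp _ (hprec_linearl z)).
- exact: (linear_mul_step _ _ hprec_linearl).
elim=> [|[d G] F IH]; first by rewrite hprec1 addr0 forest1 !mul1r.
rewrite -cat1s forestM.
exact: (dendri_mul_step (b := fun x => Bplus d (forest K G * x))
  (hprec_cons d G) IH).
Qed.

Let hprecBl z (u v : HD) : hprec (u - v) z = hprec u z - hprec v z.
Proof.
have := hprec_linearl z (-1) v u.
by rewrite !scaleN1r [- v + u]addrC [- _ + hprec u z]addrC.
Qed.

Let hprecBr x (u v : HD) : hprec x (u - v) = hprec x u - hprec x v.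
Proof.
have := hprec_linearr x (-1) v u.
by rewrite !scaleN1r [- v + u]addrC [- _ + hprec x u]addrC.
Qed.

Lemma hsucc_prec x y z : hprec (hsucc x y) z = hsucc x (hprec y z).
Proof.
apply: dendri_succ_prec_step.
- exact: hprecBr.
- exact: hprecBl.
- exact: hprec_prec.
- exact: hprec_mul.
Qed.

Lemma hsucc_succ x y z : hsucc (x * y) z = hsucc x (hsucc y z).
Proof. exact: dendri_succ_succ_step (hprec_mul x y z). Qed.

Let hprecDsucc x y : hprec x y + hsucc x y = x * y.
Proof. exact: subrKC. Qed.

Lemma hsucc_linearl y : linear (hsucc^~ y).
Proof. exact: (linear_succl_step (hprec_linearl y)). Qed.

Lemma hsucc_linearr x : linear (hsucc x).
Proof. exact: (linear_succr_step scaleMr (hprec_linearr x)). Qed.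

Theorem tree_dendriform_exists : tree_dendriform aprec asucc.
Proof.
split.
- split.
  + split=> [y c x x'|x c y y']; apply: val_inj.
      exact: hprec_linearl.
    exact: hprec_linearr.
  + split=> [y c x x'|x c y y']; apply: val_inj.
      exact: hsucc_linearl.
    exact: hsucc_linearr.
  + move=> x y z; apply: val_inj.
    transitivity (hprec (adval x) (adval y * adval z)); first exact: hprec_prec.
    by congr (hprec _ _); symmetry; apply: hprecDsucc.
  + by move=> x y z; apply: val_inj; apply: hsucc_prec.
  + move=> x y z; apply: val_inj.
    transitivity (hsucc (adval x * adval y) (adval z)); last exact: hsucc_succ.
    by congr (hsucc _ _); apply: hprecDsucc.
- by move=> x y; apply: hprecDsucc.
- move=> d x; rewrite /= /aprec /=.
  by rewrite hprec_Bplus mul1r.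
Qed.

End TreeDendriformExists.

(* Main.v *)
Require Import Defs.
From HB Require Import structures.
From mathcomp Require Import all_boot all_order all_algebra.
From mathcomp Require Import sesquilinear finmap boolp.
From mathcomp.multinomials Require Import monalg.

Set Implicit Arguments.
Unset Strict Implicit.
Unset Printing Implicit Defensive.

Import GRing.Theory.
Local Open Scope ring_scope.

(** A nonempty forest has a rightmost leaf: the leaf reached from the root of
    its last tree by always moving to the last child.  An admissible cut c of
    a forest F puts this leaf either in R^c(F) or in P^c(F).  The sum of the
    P^c(F) tensor R^c(F) over the cuts of the first kind, without the empty
    cut, is Delta_succ(F); the sum over the cuts of the second kind, without
    the total cut, is Delta_prec(F).  So the sum of both is the reduced
    coproduct, and both vanish on a one-vertex tree.

    To treat the two halves at once, give the weight a to the cuts of the first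
    kind and b to those of the second kind.  The resulting map X_(a,b), called
    wcop below, interpolates between the halves and Delta = X_(1,1).  As the
    rightmost leaf of a product x y is that of y, and grafting on a root does
    not change it,
      X(1) = a (1 tensor 1),
      X(x y) = Delta(x) X(y)  for y in the augmentation ideal,
      X(B_d x) = b (B_d x tensor 1) + (id tensor B_d) X(x).
    The first part of the proof extracts these formulas, for Delta itself, from
    the description of admissible cuts by sets of edges (sum_node_cuts): a cut
    of B_d(t_1 ... t_n) which is not total is a choice of a cut of each t_i,
    cutting the edge above t_i being the total cut of t_i.

    The rest is algebra.  The formulas give, by induction on forests, a
    weighted coassociativity (wcop_coassoc) which contains the three axioms of
    a dendriform coalgebra, and the identity
      X(x prec y) = b (x prec y tensor 1) + Delta(x) prec X(y)
    (wcop_prec), where prec on tensors multiplies the left factors and applies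
    prec to the right factors.  Removing the unit components of both sides
    yields the four axioms relating products and coproducts (redcop_prec and
    redcop_succ).

    For uniqueness, these four axioms determine both half coproducts on x prec y
    and on x succ y from their values on x and y, and the one-vertex trees
    generate the augmentation ideal under prec and succ (bul_gen_ind).  The
    same induction identifies the given dendriform structure with the explicit
    one (iota_prec). *)

Reserved Notation "v \ot w" (at level 40, left associativity).

(** * Calculus in tensor products *)

Section TensorCalculus.
Variable K : fieldType.
Implicit Types U V W : lmodType K.

Lemma pureDl V W (v1 v2 : V) (w : W) :
  (v1 + v2) \ox w = v1 \ox w + v2 \ox w.
Proof. exact: linearDl. Qed.
Lemma pureDr V W (v : V) (w1 w2 : W) :
  v \ox (w1 + w2) = v \ox w1 + v \ox w2.
Proof. exact: linearDr. Qed.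
Lemma pureZl V W c (v : V) (w : W) : (c *: v) \ox w = c *: (v \ox w).
Proof. exact: linearZl. Qed.
Lemma pureZr V W c (v : V) (w : W) : v \ox (c *: w) = c *: (v \ox w).
Proof. exact: linearZr. Qed.
(** With this key, elementary tensors and maps between tensor products are
    sealed: comparing two of them never unfolds the quotient that defines a
    tensor product. *)
Fact tensor_key : unit. Proof. exact: tt. Qed.

Definition ten V W : V -> W -> V \ox W := locked_with tensor_key (@pure K V W).
Local Notation "v \ot w" := (ten v w).

Lemma tenE V W (v : V) (w : W) : v \ot w = v \ox w.
Proof. by rewrite /ten unlock. Qed.

Fact ten_is_bilinear V W : bilinear_for *:%R *:%R (@ten V W).
Proof. by rewrite /ten unlock; apply: pure_is_bilinear. Qed.

HB.instance Definition _ V W :=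
  bilinear_isBilinear.Build K V W (V \ox W)%type *:%R *:%R (@ten V W)
    (@ten_is_bilinear V W).

Lemma tenDl V W (v1 v2 : V) (w : W) :
  (v1 + v2) \ot w = v1 \ot w + v2 \ot w.
Proof. exact: linearDl. Qed.
Lemma tenDr V W (v : V) (w1 w2 : W) :
  v \ot (w1 + w2) = v \ot w1 + v \ot w2.
Proof. exact: linearDr. Qed.
Lemma tenBl V W (v1 v2 : V) (w : W) :
  (v1 - v2) \ot w = v1 \ot w - v2 \ot w.
Proof. exact: linearBl. Qed.
Lemma tenBr V W (v : V) (w1 w2 : W) :
  v \ot (w1 - w2) = v \ot w1 - v \ot w2.
Proof. exact: linearBr. Qed.
Lemma tenZl V W c (v : V) (w : W) : (c *: v) \ot w = c *: (v \ot w).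
Proof. exact: linearZl. Qed.
Lemma tenZr V W c (v : V) (w : W) : v \ot (c *: w) = c *: (v \ot w).
Proof. exact: linearZr. Qed.
Lemma ten0l V W (w : W) : (0 : V) \ot w = 0.
Proof. exact: linear0l. Qed.
Lemma ten0r V W (v : V) : v \ot (0 : W) = 0.
Proof. exact: linear0r. Qed.

Lemma tensor_ind V W (P : V \ox W -> Prop) :
  P 0 -> (forall v w t, P t -> P (v \ot w + t)) -> forall t, P t.
Proof.
move=> P0 PD t; rewrite [t]tensorE.
elim: (enum_fset _) => [|p s IHs]; first by rewrite big_nil.
by rewrite big_cons -tenE -tenZr; apply: PD.
Qed.

Lemma tmap_bilinear U V U' V' (f : {linear U -> U'}) (g : {linear V -> V'}) :
  bilinear_for *:%R *:%R (fun u v => f u \ox g v).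
Proof.
split=> [w c v1 v2|v c w1 w2] /=.
  by rewrite linearP pureDl pureZl.
by rewrite linearP pureDr pureZr.
Qed.

Definition tensmap U V U' V' (f : U -> U') (g : V -> V') :
    U \ox V -> U' \ox V' :=
  locked_with tensor_key (tmap f g).

Fact tensmap_is_linear U V U' V' (f : {linear U -> U'}) (g : {linear V -> V'}) :
  linear (tensmap f g).
Proof.
by rewrite /tensmap unlock; exact: (tlift_is_linear (tmap_bilinear f g)).
Qed.

HB.instance Definition _ U V U' V'
    (f : {linear U -> U'}) (g : {linear V -> V'}) :=
  GRing.isLinear.Build K (U \ox V)%type (U' \ox V')%type *:%R (tensmap f g)
    (tensmap_is_linear f g).

Lemma tensmapE U V U' V' (f : {linear U -> U'}) (g : {linear V -> V'}) u v :
  tensmap f g (u \ot v) = f u \ot g v.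
Proof.
by rewrite !tenE /tensmap unlock; apply: (tliftE (tmap_bilinear f g)).
Qed.

Lemma tensmapD U V U' V' (f : {linear U -> U'}) (g : {linear V -> V'})
  (s t : U \ox V) : tensmap f g (s + t) = tensmap f g s + tensmap f g t.
Proof. exact: linearD. Qed.
Lemma tensmapB U V U' V' (f : {linear U -> U'}) (g : {linear V -> V'})
  (s t : U \ox V) : tensmap f g (s - t) = tensmap f g s - tensmap f g t.
Proof. exact: linearB. Qed.
Lemma tensmapZ U V U' V' (f : {linear U -> U'}) (g : {linear V -> V'}) c
  (t : U \ox V) : tensmap f g (c *: t) = c *: tensmap f g t.
Proof. exact: linearZ. Qed.
Lemma tensmap0 U V U' V' (f : {linear U -> U'}) (g : {linear V -> V'}) :
  tensmap f g 0 = 0.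
Proof. exact: linear0. Qed.

Lemma tensmapP U V U' V' (f : {linear U -> U'}) (g : {linear V -> V'}) c
  (s t : U \ox V) :
  tensmap f g (c *: s + t) = c *: tensmap f g s + tensmap f g t.
Proof. exact: linearP. Qed.
Lemma tensmap_sum U V U' V' (f : {linear U -> U'}) (g : {linear V -> V'})
  I (r : seq I) (F : I -> (U \ox V)%type) :
  tensmap f g (\sum_(i <- r) F i) = \sum_(i <- r) tensmap f g (F i).
Proof. exact: (big_morph _ (tensmapD f g) (tensmap0 f g)). Qed.

Lemma tassoc_inner_bilinear U V W (w : W) :
  bilinear_for *:%R *:%R (fun (u : U) (v : V) => u \ox (v \ox w)).
Proof.
split=> [v c u1 u2|u c v1 v2] /=; first by rewrite pureDl pureZl.
by rewrite pureDl pureDr pureZl pureZr.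
Qed.

(** Sweedler sums are linear in the summand too, which is what makes nested
    sums bilinear. *)
Lemma tlift_param_linear U V W (f1 f2 f3 : V -> W -> U) c t :
    bilinear_for *:%R *:%R f1 -> bilinear_for *:%R *:%R f2 ->
    bilinear_for *:%R *:%R f3 ->
    (forall v w, f3 v w = c *: f1 v w + f2 v w) ->
  tlift f3 t = c *: tlift f1 t + tlift f2 t.
Proof.
move=> b1 b2 b3 e.
pose g t := c *: tlift f1 t + tlift f2 t.
have gL : linear g.
  move=> a x y; rewrite /g !(tlift_is_linear b1) !(tlift_is_linear b2).
  by rewrite [in RHS]scalerDr addrACA scalerDr !scalerA mulrC.
pose gl : {linear (V \ox W)%type -> U} :=
  HB.pack g (GRing.isLinear.Build _ _ _ _ g gL).
symmetry; apply: (tlift_unique (g := gl)) => v w.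
by rewrite /= /g !tliftE // e.
Qed.

Lemma tassoc_bilinear U V W : bilinear_for *:%R *:%R
  (fun (s : U \ox V) (w : W) => \sw_(u, v <- s) (u \ox (v \ox w))).
Proof.
split=> [w c s1 s2|s c w1 w2] /=.
  exact: (tlift_is_linear (tassoc_inner_bilinear _ _ w)).
apply: tlift_param_linear; try exact: tassoc_inner_bilinear.
by move=> u v; rewrite !(pureDr, pureZr).
Qed.

Definition tensassoc U V W : (U \ox V) \ox W -> U \ox (V \ox W) :=
  locked_with tensor_key (@tassoc K U V W).

Fact tensassoc_is_linear U V W : linear (@tensassoc U V W).
Proof.
by rewrite /tensassoc unlock; apply: (tlift_is_linear (tassoc_bilinear U V W)).
Qed.

HB.instance Definition _ U V W :=
  GRing.isLinear.Build K ((U \ox V) \ox W)%type (U \ox (V \ox W))%type *:%R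
    (@tensassoc U V W) (@tensassoc_is_linear U V W).

Lemma tensassocE U V W (u : U) (v : V) (w : W) :
  tensassoc ((u \ot v) \ot w) = u \ot (v \ot w).
Proof.
rewrite !tenE /tensassoc unlock /tassoc (tliftE (tassoc_bilinear U V W)).
exact: (tliftE (tassoc_inner_bilinear U V w)).
Qed.

Lemma tensassocD U V W (s t : (U \ox V) \ox W) :
  tensassoc (s + t) = tensassoc s + tensassoc t.
Proof. exact: linearD. Qed.
Lemma tensassocP U V W c (s t : (U \ox V) \ox W) :
  tensassoc (c *: s + t) = c *: tensassoc s + tensassoc t.
Proof. exact: linearP. Qed.
Lemma tensassocZ U V W c (t : (U \ox V) \ox W) :
  tensassoc (c *: t) = c *: tensassoc t.
Proof. exact: linearZ. Qed.
Lemma tensassoc0 U V W : tensassoc (0 : (U \ox V) \ox W) = 0.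
Proof. exact: linear0. Qed.

(** With m and n among the associative and the dendriform products, this is
    every product of tensors that occurs in the axioms. *)
Definition tbil U U' U'' V V' V'' (m : U -> U' -> U'') (n : V -> V' -> V'')
    : U \ox V -> U' \ox V' -> U'' \ox V'' :=
  locked_with tensor_key (fun s t =>
    \sw_(u, v <- s) \sw_(u', v' <- t) (m u u' \ox n v v')).

Section TensorOperation.
Variables U U' U'' V V' V'' : lmodType K.
Variables (m : {bilinear U -> U' -> U''}) (n : {bilinear V -> V' -> V''}).

Let inner_bilinear u v :
  bilinear_for *:%R *:%R (fun u' v' => m u u' \ox n v v').
Proof.
split=> [v' c x y|u' c x y] /=.
  by rewrite linearDr linearZr pureDl pureZl.
by rewrite linearDr linearZr pureDr pureZr.
Qed.

Let outer_bilinear t : bilinear_for *:%R *:%R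
  (fun u v => \sw_(u', v' <- t) (m u u' \ox n v v')).
Proof.
split=> [v c x y|u c x y] /=; apply: tlift_param_linear;
  try exact: inner_bilinear.
  by move=> u' v'; rewrite linearDl linearZl pureDl pureZl.
by move=> u' v'; rewrite linearDl linearZl pureDr pureZr.
Qed.

Lemma tbil_is_bilinear : bilinear_for *:%R *:%R (tbil m n).
Proof.
rewrite /tbil unlock; split=> [t c s1 s2|s c t1 t2] /=.
  exact: (tlift_is_linear (outer_bilinear t)).
apply: tlift_param_linear; try exact: outer_bilinear.
by move=> u v; apply: (tlift_is_linear (inner_bilinear u v)).
Qed.

HB.instance Definition _ :=
  bilinear_isBilinear.Build K _ _ _ *:%R *:%R (tbil m n) tbil_is_bilinear.

Lemma tbilE u v u' v' :
  tbil m n (u \ot v) (u' \ot v') = m u u' \ot n v v'.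
Proof.
rewrite !tenE /tbil unlock (tliftE (outer_bilinear _)).
exact: (tliftE (inner_bilinear u v)).
Qed.

Lemma tbilDl s1 s2 t : tbil m n (s1 + s2) t = tbil m n s1 t + tbil m n s2 t.
Proof. exact: linearDl. Qed.
Lemma tbilDr s t1 t2 : tbil m n s (t1 + t2) = tbil m n s t1 + tbil m n s t2.
Proof. exact: linearDr. Qed.
Lemma tbilBr s t1 t2 : tbil m n s (t1 - t2) = tbil m n s t1 - tbil m n s t2.
Proof. exact: linearBr. Qed.
Lemma tbilZl c s t : tbil m n (c *: s) t = c *: tbil m n s t.
Proof. exact: linearZl. Qed.
Lemma tbilZr c s t : tbil m n s (c *: t) = c *: tbil m n s t.
Proof. exact: linearZr. Qed.
Lemma tbil0l t : tbil m n 0 t = 0.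
Proof. exact: linear0l. Qed.
Lemma tbil0r s : tbil m n s 0 = 0.
Proof. exact: linear0r. Qed.
Lemma tbil_suml I (r : seq I) (F : I -> (U \ox V)%type) t :
  tbil m n (\sum_(i <- r) F i) t = \sum_(i <- r) tbil m n (F i) t.
Proof. exact: (big_morph _ (fun x y => tbilDl x y t) (tbil0l t)). Qed.
Lemma tbil_sumr I (r : seq I) s (F : I -> (U' \ox V')%type) :
  tbil m n s (\sum_(i <- r) F i) = \sum_(i <- r) tbil m n s (F i).
Proof. exact: (big_morph _ (tbilDr s) (tbil0r s)). Qed.

End TensorOperation.

Lemma tensmap_sweedler U V U' V' (f : U -> U') (g : V -> V') (t : U \ox V) :
  tensmap f g t = \sw_(u, v <- t) (f u \ox g v).
Proof. by rewrite /tensmap unlock. Qed.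

Lemma tensassoc_sweedler U V W (t : (U \ox V) \ox W) :
  tensassoc t = tassoc t.
Proof. by rewrite /tensassoc unlock. Qed.

Lemma tbil_sweedler U U' U'' V V' V'' (m : U -> U' -> U'') (n : V -> V' -> V'')
    (s : U \ox V) (t : U' \ox V') : tbil m n s t
  = \sw_(u, v <- s) \sw_(u', v' <- t) (m u u' \ox n v v').
Proof. by rewrite /tbil unlock. Qed.

End TensorCalculus.

Notation "v \ot w" := (ten v w) : ring_scope.

(** * Rearrangements in a module *)

Section ModuleIdentities.
Variables (K : fieldType) (V : lmodType K).
Implicit Types (x y z : V) (a b c : K).

Lemma eq_addl x y z : x = y -> x + z = y + z.
Proof. by move->. Qed.

Lemma eq_add2 (x x' y y' : V) : x = x' -> y = y' -> x + y = x' + y'.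
Proof. by move=> -> ->. Qed.

Lemma eq_scale_comb (a b c a' b' c' : K) (x y : V) :
  c * a = c' * a' -> c * b = c' * b' ->
  c *: (a *: x + b *: y) = c' *: (a' *: x + b' *: y).
Proof. by move=> ea eb; rewrite !scalerDr !scalerA ea eb. Qed.

Lemma scaler_lincomb a c x y x' y' :
  c *: (a *: x + x') + (a *: y + y') = a *: (c *: x + y) + (c *: x' + y').
Proof. by rewrite !scalerDr addrACA !scalerA mulrC. Qed.

Lemma subr_swap x y z : x - (y + z) = x - z - y.
Proof. by rewrite opprD addrA addrAC. Qed.

Lemma addr_peel x y z : z = x + y + z - y - x.
Proof. by rewrite [x + y + z]addrC addrA !addrK. Qed.

Lemma addr_unit_part (x y z t : V) :
  t + (x + y + (z - x - y)) = z + t.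
Proof. by rewrite -[z - x - y]addrA -opprD [x + y + _]addrC subrK addrC. Qed.

Lemma addr_cancel_mid (p q z a1 a2 a3 : V) :
  p + z + (a1 + a2) + (q + (a3 - z)) = p + q + (a1 + (a2 + a3)).
Proof.
rewrite [LHS](AC ((2*2)*(1*2)) ((1*5)*(3*(4*6))*(2*7))).
by rewrite /= subrr addr0.
Qed.

Lemma addr_expand9 (t1 t2 t3 t4 t5 t6 t7 : V) :
  (0 + t1 + t2) + (t3 + 0 + t4) + (t5 + t6 + t7)
  = t7 + t5 + t6 + t2 + t4 + t3 + t1.
Proof. by rewrite add0r addr0 [LHS](AC ((2*2)*3) (7*5*6*2*4*3*1)). Qed.

End ModuleIdentities.

(** * Tensor products of operations *)

Section TensorIdentities.
Variable K : fieldType.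

Lemma linear_weighted (U V : lmodType K) (f g : {linear U -> V}) (a b : K) :
  linear (fun x => a *: f x + b *: (g x - f x)).
Proof.
move=> c x y; rewrite (linearP f) (linearP g) opprD addrACA -scalerBr.
by rewrite !scalerDr addrACA !scalerA ![_ * c]mulrC.
Qed.

Lemma tbil_assoc (U V : lmodType K)
    (m : {bilinear U -> U -> U}) (n : {bilinear V -> V -> V}) s t u :
    associative m -> associative n ->
  tbil m n s (tbil m n t u) = tbil m n (tbil m n s t) u.
Proof.
move=> mA nA.
elim/tensor_ind: s => [|x x' s IHs]; first by rewrite !tbil0l.
rewrite !tbilDl IHs; apply: eq_addl => {s IHs}.
elim/tensor_ind: t => [|y y' t IHt]; first by rewrite !(tbil0l, tbil0r).
rewrite !(tbilDl, tbilDr) IHt; apply: eq_addl => {t IHt}.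
elim/tensor_ind: u => [|z z' u IHu]; first by rewrite !tbil0r.
by rewrite !tbilDr IHu !tbilE mA nA.
Qed.

Lemma tbil_unitl (U V : lmodType K)
    (m : {bilinear U -> U -> U}) (n : {bilinear V -> V -> V}) e e' s :
  left_id e m -> left_id e' n -> tbil m n (e \ot e') s = s.
Proof.
move=> me ne; elim/tensor_ind: s => [|u v s IH]; first by rewrite tbil0r.
by rewrite tbilDr IH tbilE me ne.
Qed.

Lemma tbil_unitr (U V : lmodType K)
    (m : {bilinear U -> U -> U}) (n : {bilinear V -> V -> V}) e e' s :
  right_id e m -> right_id e' n -> tbil m n s (e \ot e') = s.
Proof.
move=> me ne; elim/tensor_ind: s => [|u v s IH]; first by rewrite tbil0l.
by rewrite tbilDl IH tbilE me ne.
Qed.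

Lemma tensmap_comp (U V U' V' U'' V'' : lmodType K)
    (f : {linear U -> U'}) (g : {linear V -> V'})
    (f' : {linear U' -> U''}) (g' : {linear V' -> V''})
    (f'' : {linear U -> U''}) (g'' : {linear V -> V''}) (t : U \ox V) :
    (forall x, f' (f x) = f'' x) -> (forall x, g' (g x) = g'' x) ->
  tensmap f' g' (tensmap f g t) = tensmap f'' g'' t.
Proof.
move=> ef eg; elim/tensor_ind: t => [|x y t IH]; first by rewrite !tensmap0.
by rewrite !tensmapD IH !tensmapE ef eg.
Qed.

Lemma tensmap_eq0 (U V U' V' : lmodType K)
    (f : {linear U -> U'}) (g : {linear V -> V'}) (t : U \ox V) :
  (forall y, g y = 0) -> tensmap f g t = 0.
Proof.
move=> g0; elim/tensor_ind: t => [|x y t IH]; first by rewrite tensmap0.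
by rewrite tensmapD IH tensmapE g0 ten0r addr0.
Qed.

Lemma eq_tensmap (U V U' V' : lmodType K)
    (f f' : {linear U -> U'}) (g g' : {linear V -> V'}) (t : U \ox V) :
  f =1 f' -> g =1 g' -> tensmap f g t = tensmap f' g' t.
Proof.
move=> ef eg; elim/tensor_ind: t => [|x y t IH]; first by rewrite !tensmap0.
by rewrite !tensmapD IH !tensmapE ef eg.
Qed.

Lemma tensmap_id (U V : lmodType K) (t : U \ox V) : tensmap idfun idfun t = t.
Proof.
elim/tensor_ind: t => [|x y t IH]; first by rewrite tensmap0.
by rewrite tensmapD IH tensmapE.
Qed.

Lemma tensmapBl (U V U' V' : lmodType K)
    (f f' f'' : {linear U -> U'}) (g : {linear V -> V'}) (t : U \ox V) :
    (forall x, f x = f' x - f'' x) ->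
  tensmap f g t = tensmap f' g t - tensmap f'' g t.
Proof.
move=> ef; elim/tensor_ind: t => [|x y t IH]; first by rewrite !tensmap0 subr0.
by rewrite !tensmapD IH !tensmapE ef tenBl addrACA opprD.
Qed.

Lemma tensmapBr (U V U' V' : lmodType K)
    (f : {linear U -> U'}) (g g' g'' : {linear V -> V'}) (t : U \ox V) :
    (forall y, g y = g' y - g'' y) ->
  tensmap f g t = tensmap f g' t - tensmap f g'' t.
Proof.
move=> eg; elim/tensor_ind: t => [|x y t IH]; first by rewrite !tensmap0 subr0.
by rewrite !tensmapD IH !tensmapE eg tenBr addrACA opprD.
Qed.

Lemma tensassoc_pure (U V W : lmodType K) (s : U \ox V) (w : W) :
  tensassoc (s \ot w) = tensmap idfun (applyr (@ten K V W) w) s.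
Proof.
elim/tensor_ind: s => [|u v s IH].
  by rewrite ten0l tensassoc0 tensmap0.
by rewrite tenDl tensassocD IH tensassocE tensmapD tensmapE.
Qed.

Lemma tensassoc_tensmap (U V W U' V' W' : lmodType K) (f : {linear U -> U'})
    (g : {linear V -> V'}) (h : {linear W -> W'}) (t : (U \ox V) \ox W) :
  tensassoc (tensmap (tensmap f g) h t) = tensmap f (tensmap g h) (tensassoc t).
Proof.
elim/tensor_ind: t => [|s w t IH]; first by rewrite !(tensmap0, tensassoc0).
rewrite !(tensmapD, tensassocD) IH; apply: eq_addl.
rewrite tensmapE !tensassoc_pure.
pose gh : {linear V -> (V' \ox W')%type} := applyr (@ten K V' W') (h w) \o g.
rewrite (tensmap_comp (f'' := f) (g'' := gh)) //.
by rewrite (tensmap_comp (f'' := f) (g'' := gh)) // => v; apply: tensmapE.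
Qed.

Section Transport.
Variables U U' U'' V V' V'' X X' X'' Y Y' Y'' : lmodType K.
Variables (m : {bilinear U -> U' -> U''}) (n : {bilinear V -> V' -> V''}).
Variables (f : {linear U'' -> X''}) (g : {linear V'' -> Y''}).

Lemma tensmap_tbil
    (m' : {bilinear X -> X' -> X''}) (n' : {bilinear Y -> Y' -> Y''})
    (h : {linear X -> U}) (k : {linear Y -> V})
    (h' : {linear X' -> U'}) (k' : {linear Y' -> V'}) s t :
    (forall x x', f (m (h x) (h' x')) = m' x x') ->
    (forall y y', g (n (k y) (k' y')) = n' y y') ->
  tensmap f g (tbil m n (tensmap h k s) (tensmap h' k' t)) = tbil m' n' s t.
Proof.
move=> em en.
elim/tensor_ind: s => [|x y s IHs]; first by rewrite !(tbil0l, tensmap0).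
rewrite !(tbilDl, tensmapD) IHs; apply: eq_addl => {s IHs}.
elim/tensor_ind: t => [|x' y' t IHt]; first by rewrite !(tbil0r, tensmap0).
rewrite !(tbilDr, tensmapD) IHt; apply: eq_addl => {t IHt}.
by rewrite !(tensmapE, tbilE) em en.
Qed.

Lemma tensmap_tbil_morph
    (m' : {bilinear X -> X' -> X''}) (n' : {bilinear Y -> Y' -> Y''})
    (h : {linear U -> X}) (k : {linear V -> Y})
    (h' : {linear U' -> X'}) (k' : {linear V' -> Y'}) s t :
    (forall x x', f (m x x') = m' (h x) (h' x')) ->
    (forall y y', g (n y y') = n' (k y) (k' y')) ->
  tensmap f g (tbil m n s t) = tbil m' n' (tensmap h k s) (tensmap h' k' t).
Proof.
move=> em en.
elim/tensor_ind: s => [|x y s IHs]; first by rewrite !(tbil0l, tensmap0).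
rewrite !(tbilDl, tensmapD) IHs; apply: eq_addl => {s IHs}.
elim/tensor_ind: t => [|x' y' t IHt]; first by rewrite !(tbil0r, tensmap0).
rewrite !(tbilDr, tensmapD) IHt; apply: eq_addl => {t IHt}.
by rewrite !(tensmapE, tbilE) em en.
Qed.

Lemma tensmap_tbil_purel (p : {linear X' -> X''}) (q : {linear Y' -> Y''})
    (h' : {linear X' -> U'}) (k' : {linear Y' -> V'}) u v t :
    (forall x', f (m u (h' x')) = p x') ->
    (forall y', g (n v (k' y')) = q y') ->
  tensmap f g (tbil m n (u \ot v) (tensmap h' k' t)) = tensmap p q t.
Proof.
move=> em en.
elim/tensor_ind: t => [|x' y' t IHt]; first by rewrite !(tbil0r, tensmap0).
by rewrite !(tbilDr, tensmapD) IHt !(tensmapE, tbilE) em en.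
Qed.

Lemma tensmap_tbil_purer (p : {linear X -> X''}) (q : {linear Y -> Y''})
    (h : {linear X -> U}) (k : {linear Y -> V}) u' v' s :
    (forall x, f (m (h x) u') = p x) ->
    (forall y, g (n (k y) v') = q y) ->
  tensmap f g (tbil m n (tensmap h k s) (u' \ot v')) = tensmap p q s.
Proof.
move=> em en.
elim/tensor_ind: s => [|x y s IHs]; first by rewrite !(tbil0l, tensmap0).
by rewrite !(tbilDl, tensmapD) IHs !(tensmapE, tbilE) em en.
Qed.

End Transport.

End TensorIdentities.

(** * Admissible cuts of a grafted tree *)

Section SubseqSums.
Variables (V : nmodType) (T : eqType).
Implicit Type s : seq T.

Lemma big_subseqs_cat s1 s2 (F : seq T -> V) :
  \sum_(c <- subseqs (s1 ++ s2)) F c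
  = \sum_(a <- subseqs s1) \sum_(b <- subseqs s2) F (a ++ b).
Proof.
elim: s1 F => [|x s1 IH] F /=; first by rewrite big_seq1.
by rewrite !big_cat !big_map !IH.
Qed.

Lemma subseqs_map (T' : Type) (f : T' -> T) (s : seq T') :
  subseqs (map f s) = map (map f) (subseqs s).
Proof.
by elim: s => //= x s ->; rewrite map_cat -!map_comp.
Qed.

Lemma mem_subseqs s c : c \in subseqs s -> {subset c <= s}.
Proof.
elim: s c => [|x s IH] c /=; first by rewrite inE => /eqP->.
rewrite mem_cat => /orP[/mapP[u us ->]|/IH cs] y; rewrite !inE.
  by case/orP=> [->//|/(IH _ us)->]; rewrite orbT.
by move/cs->; rewrite orbT.
Qed.

Lemma subseqs_nil_last s :
  exists2 u, subseqs s = rcons u [::] & all (fun c => c != [::]) u.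
Proof.
elim: s => [|x s [u us nu]]; first by exists [::].
exists (map (cons x) (rcons u [::]) ++ u); first by rewrite /= us rcons_cat.
by rewrite all_cat nu andbT all_map; apply/allP.
Qed.

End SubseqSums.

Section CutsOfForests.
Variable D : choiceType.
Implicit Types (t : ptree D) (F : seq (ptree D)).

(** The counterparts of vertices, leaves and component for a forest whose trees
    are the children number k, k + 1, and so on, of a common root; keeping the
    offset k allows induction on the forest. *)
Fixpoint fverts (k : nat) F : seq (seq nat) :=
  if F is t :: F' then map (cons k) (vertices t) ++ fverts k.+1 F' else [::].

Fixpoint fleaves (k : nat) F : seq (seq nat) :=
  if F is t :: F' then map (cons k) (leaves t) ++ fleaves k.+1 F' else [::].

Fixpoint fcomp (c : seq (seq nat)) (v : seq nat) (k : nat) F : seq (ptree D) :=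
  if F is t :: F' then
    (if rcons v k \in c then [::] else [:: component c t (rcons v k)])
    ++ fcomp c v k.+1 F'
  else [::].

Lemma vertices_node d F : vertices (PNode d F) = [::] :: fverts 0 F.
Proof.
rewrite /=; congr (_ :: _); elim: F 0%N => //= t F IH k.
by rewrite -IH.
Qed.

Lemma edges_node d F : edges (PNode d F) = fverts 0 F.
Proof. by rewrite /edges vertices_node. Qed.

Lemma verticesE t : vertices t = [::] :: edges t.
Proof. by case: t => d F; rewrite edges_node vertices_node. Qed.

Lemma component_node c d F v :
  component c (PNode d F) v = PNode d (fcomp c v 0 F).
Proof.
rewrite /=; congr (PNode _ _); elim: F 0%N => //= t F IH k.
by rewrite -IH; case: (rcons v k \in c).
Qed.

(** A component only depends on the cut edges below its root, so it can be
    computed inside a subtree. *)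
Lemma component_ext c c' t v v' :
    (forall w, (v ++ w \in c) = (v' ++ w \in c')) ->
  component c t v = component c' t v'.
Proof.
elim/ptree_ind': t v v' => d F IH v v' e; rewrite !component_node; congr PNode.
elim: F 0%N IH => //= t F IHF k [IHt IH]; rewrite -!cats1 e IHF //.
by case: ifP => // _; rewrite (IHt _ (v' ++ [:: k])) // => w; rewrite -!catA e.
Qed.

Lemma component_id c t v :
  (forall w, w != [::] -> v ++ w \notin c) -> component c t v = t.
Proof.
elim/ptree_ind': t v => d F IH v e; rewrite !component_node; congr PNode.
elim: F 0%N IH => //= t F IHF k [IHt IH]; rewrite -!cats1 (negbTE (e _ _)) //.
by rewrite IHF // IHt // => w w0; rewrite -!catA e.
Qed.

Lemma mem_fverts_gt k F e :
  e \in fverts k F -> exists i v, e = i :: v /\ (k <= i)%N.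
Proof.
elim: F k => //= t F IH k; rewrite mem_cat => /orP[/mapP[v _ ->]|/IH].
  by exists k, v.
by move=> [i [v [-> ki]]]; exists i, v; split=> //; apply: ltnW.
Qed.

Lemma mem_fleaves_gt k F e :
  e \in fleaves k F -> exists i v, e = i :: v /\ (k <= i)%N.
Proof.
elim: F k => //= t F IH k; rewrite mem_cat => /orP[/mapP[v _ ->]|/IH].
  by exists k, v.
by move=> [i [v [-> ki]]]; exists i, v; split=> //; apply: ltnW.
Qed.

Lemma leaves_node d t F : leaves (PNode d (t :: F)) = fleaves 0 (t :: F).
Proof.
have H F0 F1 : [seq v <- fverts (size F0) F1
      | nilp (children (subtree (PNode d (F0 ++ F1)) v))]
    = fleaves (size F0) F1.
  elim: F1 F0 => //= {}t {}F IH F0; rewrite filter_cat filter_map.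
  rewrite -cat_rcons -(size_rcons F0 t) IH; congr (map _ _ ++ _).
  by apply: eq_filter => v /=; rewrite cat_rcons nth_cat ltnn subnn.
by rewrite /leaves vertices_node -(H [::]).
Qed.

Lemma vertex_below_leaf t e :
  e \in vertices t -> exists2 l, l \in leaves t & prefix e l.
Proof.
elim/ptree_ind': t e => d [|t F] IH e.
  by rewrite vertices_node inE => /eqP->; exists [::].
rewrite vertices_node leaves_node.
have H k F' e' : foldr (fun t => and (forall e, e \in vertices t ->
      exists2 l, l \in leaves t & prefix e l)) True F' ->
    e' \in fverts k F' -> exists2 l, l \in fleaves k F' & prefix e' l.
  elim: F' k => //= t' F' IHF k [IHt IH']; rewrite mem_cat.
  case/orP=> [/mapP[v /IHt[l lt vl] ->]|/IHF[]// l ll el].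
    by exists (k :: l); rewrite ?mem_cat ?map_f //= eqxx.
  by exists l => //; rewrite mem_cat ll orbT.
rewrite inE => /orP[/eqP->|]; last exact: H.
have [l ll _] : exists2 l, l \in fleaves 0 (t :: F) & prefix [:: 0%N] l.
  by apply: H => //=; rewrite mem_cat map_f // verticesE mem_head.
by exists l => //; exact: prefix0s.
Qed.

(** Admissibility without the nonemptiness required by admissible, which lets
    the conditions on the subtrees be checked independently. *)
Definition wadm (ls c : seq (seq nat)) : bool :=
  all (fun l => count (fun e => prefix e l) c <= 1)%N ls.

(** An admissible set containing the edge above a tree contains no edge of the
    tree: such an edge lies on a path to some leaf, and that path already
    contains the first one. *)
Lemma wadm_root t c : c != [::] -> {subset c <= edges t} ->
  ~~ wadm (leaves t) ([::] :: c).
Proof.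
case: c => // e c _ ct; apply/negP => /allP h.
have [|l /h] := @vertex_below_leaf t e.
  by rewrite verticesE inE ct ?mem_head ?orbT.
by move=> /= + el; rewrite el ?prefix0s.
Qed.

Section TreeSum.
Variables (V : nmodType) (t : ptree D).
Variable g : seq (ptree D) -> seq (ptree D) -> V.

Lemma sum_wadm_edges (f : seq (seq nat) -> V) :
  \sum_(c <- subseqs (edges t) | wadm (leaves t) c) f c
  = f [::] + \sum_(c <- [seq c <- subseqs (edges t) | admissible t c]) f c.
Proof.
have [u -> nu] := subseqs_nil_last (edges t).
rewrite -cats1 filter_cat /= cats0 big_cat /= big_cons big_nil addr0.
have -> : wadm (leaves t) [::] by apply/allP.
rewrite addrC big_filter; congr (_ + _).
rewrite big_seq_cond [RHS]big_seq_cond; apply: eq_bigl => c.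
by case: (boolP (c \in u)) => //= /(allP nu) c0; rewrite /admissible c0.
Qed.

(** The edges of a tree together with the edge above it correspond to its
    vertices.  A set containing the root is reduced to it by wadm_root and
    stands for the total cut; the other sets are the remaining cuts. *)
Lemma sum_tree_cuts :
  \sum_(a <- subseqs (vertices t) | wadm (leaves t) a)
    g [seq component a (subtree t e) e | e <- a]
      (if [::] \in a then [::] else [:: component a t [::]])
  = \sum_(c <- adm_cuts t) g (cut_P t c) (cut_R t c).
Proof.
rewrite verticesE /adm_cuts /= big_cat /= !big_cons !big_map; congr (_ + _).
  have [u us nu] := subseqs_nil_last (edges t).
  rewrite us -cats1 big_cat /= big_cons big_nil addr0 big_seq_cond big1.
    rewrite add0r; have -> : wadm (leaves t) [:: [::]].
      by apply/allP => l _ /=; rewrite prefix0s.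
    by rewrite /= component_id // => -[].
  move=> c /andP[cu]; rewrite (negbTE (wadm_root _ _)) ?(allP nu) //.
  by apply: mem_subseqs; rewrite us mem_rcons inE cu orbT.
rewrite -(sum_wadm_edges (fun c => g (cut_P t (Some c)) (cut_R t (Some c)))).
rewrite big_seq_cond [RHS]big_seq_cond.
apply: eq_bigr => c /andP[/mem_subseqs cs _].
case: ifP => // /cs; case: t => d F; rewrite edges_node => /mem_fverts_gt.
by move=> [i [v []]].
Qed.

End TreeSum.

(** A set of edges of the tree with children F0 ++ F which avoids the first
    size F0 children splits into one set for each tree of F.  The prefix F0 is
    there because edges are named by the positions of the children. *)
Lemma sum_forest_cuts (V : nmodType) d F0 F
    (g : seq (ptree D) -> seq (ptree D) -> V) :
  \sum_(c <- subseqs (fverts (size F0) F) | wadm (fleaves (size F0) F) c)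
    g [seq component c (subtree (PNode d (F0 ++ F)) e) e | e <- c]
      (fcomp c [::] (size F0) F)
  = \sum_(cs <- adm_cuts_forest F) g (forest_P F cs) (forest_R F cs).
Proof.
elim: F F0 g => [|t F IH] F0 g; first by rewrite /= !big_seq1.
have -> : adm_cuts_forest (t :: F)
  = [seq c :: cs | c <- adm_cuts t, cs <- adm_cuts_forest F] by [].
rewrite big_allpairs_dep.
apply: etrans (sum_tree_cuts t (fun p r => \sum_(cs <- adm_cuts_forest F)
  g (p ++ forest_P F cs) (r ++ forest_R F cs))).
rewrite [fverts _ _]/= big_mkcond big_subseqs_cat subseqs_map big_map.
rewrite [RHS]big_mkcond; apply: eq_bigr => a _.
(* The set is now map (cons k) a ++ b, with a in the first tree t of F and b in
   the other trees; neither part sees the other. *)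
set k := size F0; rewrite -[k.+1](size_rcons F0 t).
have notb b w : b \in subseqs (fverts (size (rcons F0 t)) F) -> k :: w \notin b.
  move=> /mem_subseqs bs; apply/negP => /bs /mem_fverts_gt[i [v [[<- _]]]].
  by rewrite size_rcons ltnn.
have nota i v : (k < i)%N -> i :: v \notin map (cons k) a.
  by move=> ki; apply/mapP => -[w _ [ik _]]; rewrite ik ltnn in ki.
have admE b : b \in subseqs (fverts (size (rcons F0 t)) F) ->
    wadm (fleaves k (t :: F)) (map (cons k) a ++ b)
    = wadm (leaves t) a && wadm (fleaves (size (rcons F0 t)) F) b.
  move=> bs; rewrite /wadm [fleaves _ _]/= all_cat all_map; congr andb.
    apply: eq_all => l /=; rewrite count_cat count_map.
    rewrite [X in (_ + X)%N](_ : _ = 0)%N ?addn0; last first.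
      apply/eqP; rewrite -leqn0 leqNgt -has_count; apply/hasPn => e eb.
      have [i [v [ee ki]]] := mem_fverts_gt (mem_subseqs bs eb).
      rewrite ee /= (negbTE (_ : i != k)) //.
      by rewrite size_rcons in ki; rewrite gtn_eqF.
    by congr (_ <= _)%N; apply: eq_count => e /=; rewrite eqxx.
  rewrite size_rcons; apply: eq_in_all => l /mem_fleaves_gt[i [v [-> ki]]].
  rewrite count_cat count_map [X in (X + _)%N](_ : _ = 0)%N //.
  apply/eqP; rewrite -leqn0 leqNgt -has_count; apply/hasPn => e _ /=.
  by rewrite (negbTE (_ : k != i)) // ltn_eqF.
have PE b : b \in subseqs (fverts (size (rcons F0 t)) F) ->
    [seq component (map (cons k) a ++ b) (subtree (PNode d (F0 ++ t :: F)) e) e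
       | e <- map (cons k) a ++ b]
    = [seq component a (subtree t e) e | e <- a]
      ++ [seq component b (subtree (PNode d (rcons F0 t ++ F)) e) e | e <- b].
  move=> bs; rewrite map_cat -map_comp; congr (_ ++ _).
    apply: eq_map => e; rewrite [LHS]/= nth_cat ltnn subnn /=.
    apply: component_ext => w.
    rewrite cat_cons mem_cat (negbTE (notb _ _ bs)) orbF.
    by rewrite (mem_map (f := cons k)) // => x y [].
  apply/eq_in_map => e /(mem_subseqs bs) /mem_fverts_gt[i [v [-> ki]]].
  rewrite cat_rcons; apply: component_ext => w; rewrite mem_cat.
  by rewrite (negbTE (nota _ _ _)) // -(size_rcons F0 t).
have RE b : b \in subseqs (fverts (size (rcons F0 t)) F) ->
    fcomp (map (cons k) a ++ b) [::] k (t :: F)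
    = (if [::] \in a then [::] else [:: component a t [::]])
      ++ fcomp b [::] (size (rcons F0 t)) F.
  move=> bs /=; rewrite mem_cat (negbTE (notb _ _ bs)) orbF.
  rewrite (mem_map (f := cons k)); last by move=> x y [].
  rewrite (_ : component _ t [:: k] = component a t [::]); last first.
    apply: component_ext => w.
    rewrite cat_cons mem_cat (negbTE (notb _ _ bs)) orbF.
    by rewrite (mem_map (f := cons k)) // => x y [].
  congr (_ ++ _); rewrite size_rcons.
  have H i F' : (k < i)%N ->
      fcomp (map (cons k) a ++ b) [::] i F' = fcomp b [::] i F'.
    elim: F' i => //= t' F' IHF i ki; rewrite mem_cat (negbTE (nota _ _ ki)).
    rewrite /= IHF 1?ltnW //; congr (_ ++ _); case: ifP => // _.
    congr [:: _]; apply: component_ext => w.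
    by rewrite mem_cat (negbTE (nota _ _ ki)).
  exact: H.
rewrite big_seq; under eq_bigr => b bs do rewrite admE // PE // RE //.
rewrite -big_seq; case: (wadm (leaves t) a); last by rewrite big1.
rewrite -big_mkcond /=.
exact: (IH (rcons F0 t) (fun p r => g (_ ++ p) (_ ++ r))).
Qed.

(** The total cut gives the first term; all the others are given by
    independent cuts of the subtrees at the root.  On coproducts this says that
    grafting is a cocycle. *)
Lemma sum_node_cuts (V : nmodType) d F
    (g : seq (ptree D) -> seq (ptree D) -> V) :
  \sum_(c <- adm_cuts (PNode d F))
    g (cut_P (PNode d F) c) (cut_R (PNode d F) c)
  = g [:: PNode d F] [::]
    + \sum_(cs <- adm_cuts_forest F)
        g (forest_P F cs) [:: PNode d (forest_R F cs)].
Proof.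
rewrite /adm_cuts !big_cons big_map; congr (_ + _).
pose t := PNode d F.
rewrite -(sum_wadm_edges t (fun c => g (cut_P t (Some c)) (cut_R t (Some c)))).
rewrite -(@sum_forest_cuts V d [::] F (fun p r => g p [:: PNode d r])) /t.
rewrite edges_node big_mkcond [RHS]big_mkcond.
case: F {t} => [|t F]; first by rewrite /= !big_seq1.
rewrite leaves_node; apply: eq_bigr => c _.
by rewrite /cut_P /cut_R component_node.
Qed.

End CutsOfForests.

(** * The algebra of forests *)

(** H stands for the algebra of forests, with fo F the basis element of the
    forest F and B the grafting operators; A stands for its augmentation ideal,
    with iota the inclusion and proj the projection along the unit.  Leaving
    them abstract separates the argument from the encoding of forests. *)
Section ForestModel.
Variables (K : fieldType) (D : choiceType) (H A : lmodType K).
Variables (mul prec : {bilinear H -> H -> H}) (one : H).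
Variables (fo : seq (ptree D) -> H) (B : D -> {linear H -> H}).
Variables (cop trunk : {linear H -> (H \ox H)%type}).
Variables (eps : H -> K) (iota : {linear A -> H}) (proj : {linear H -> A}).
Local Notation HH := (H \ox H)%type.
Local Notation tmul := (tbil mul mul).
Local Notation graft d := (tensmap idfun (B d)).
Implicit Types (a b c e : K) (d : D) (t : ptree D) (F G : seq (ptree D)).
Implicit Types (x y z : H) (s u : HH) (v w : A).

Hypothesis fo_span : forall P : H -> Prop,
  (forall c x y, P x -> P y -> P (c *: x + y)) ->
  (forall F, P (fo F)) -> forall x, P x.
Hypothesis fo_nil : fo [::] = one.
Hypothesis fo_cat : forall F G, fo (F ++ G) = mul (fo F) (fo G).
Hypothesis B_fo : forall d F, B d (fo F) = fo [:: PNode d F].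
Hypothesis mulA : associative mul.
Hypothesis mul1x : left_id one mul.
Hypothesis mulx1 : right_id one mul.
Hypothesis cop_fo : forall F, cop (fo F) =
  \sum_(c <- adm_cuts_forest F) (fo (forest_P F c) \ot fo (forest_R F c)).
Hypothesis epsP : forall c x y, eps (c *: x + y) = c * eps x + eps y.
Hypothesis eps_fo : forall F, eps (fo F) = (nilp F)%:R.
Hypothesis iota_proj : forall x, iota (proj x) = x - eps x *: one.
Hypothesis iotaK : cancel iota proj.
Hypothesis prec_one : forall y, prec one y = 0.
Hypothesis prec_cons : forall d G F y, prec (fo (PNode d G :: F)) y =
  mul (fo [:: PNode d G]) (prec (fo F) y)
  + B d (mul (fo G) (mul (fo F) y - prec (fo F) y)).
Hypothesis prec_mul : forall x y z,
  prec (mul x y) z = mul x (prec y z) + prec x (mul y z - prec y z).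
Hypothesis eps_prec : forall x y, eps (prec x y) = 0.

(** The cuts that leave the rightmost leaf in the trunk R^c: the last tree is
    cut in this way and the others arbitrarily; in a tree B_d(G) the rightmost
    leaf is that of G, or the root itself if G is empty. *)
Definition forest_trunk (tr : ptree D -> HH) : seq (ptree D) -> HH :=
  fix go F := if F is t :: F' then
    if F' is [::] then tr t else tmul (cop (fo [:: t])) (go F')
  else one \ot one.

Fixpoint tree_trunk t : HH :=
  let: PNode d G := t in graft d (forest_trunk tree_trunk G).

Hypothesis trunk_fo : forall F, trunk (fo F) = forest_trunk tree_trunk F.

(** * Multiplicativity and cocycle property of the coproduct *)

Lemma cop_tree t : cop (fo [:: t]) =
  \sum_(k <- adm_cuts t) (fo (cut_P t k) \ot fo (cut_R t k)).
Proof.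
rewrite cop_fo.
have -> : adm_cuts_forest [:: t]
  = [seq k :: cs | k <- adm_cuts t, cs <- [:: [::]]] by [].
rewrite big_allpairs_dep; apply: eq_bigr => k _; rewrite big_seq1.
by rewrite /forest_P /forest_R /= !cats0.
Qed.

Lemma cop_one : cop one = one \ot one.
Proof. by rewrite -fo_nil cop_fo /= big_seq1. Qed.

Lemma tmul1 s : tmul (one \ot one) s = s.
Proof. exact: tbil_unitl. Qed.

Lemma tmulx1 s : tmul s (one \ot one) = s.
Proof. exact: tbil_unitr. Qed.

Lemma tmulA s1 s2 s3 : tmul s1 (tmul s2 s3) = tmul (tmul s1 s2) s3.
Proof. exact: tbil_assoc. Qed.

Lemma cop_cons t F : cop (fo (t :: F)) = tmul (cop (fo [:: t])) (cop (fo F)).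
Proof.
rewrite cop_tree !cop_fo tbil_suml.
have -> : adm_cuts_forest (t :: F)
  = [seq k :: cs | k <- adm_cuts t, cs <- adm_cuts_forest F] by [].
rewrite big_allpairs_dep; apply: eq_bigr => k _.
rewrite tbil_sumr; apply: eq_bigr => cs _.
by rewrite tbilE -!fo_cat.
Qed.

Lemma mulP1 c x y z : mul (c *: x + y) z = c *: mul x z + mul y z.
Proof. by rewrite linearDl linearZl. Qed.

Lemma mulP2 c x y z : mul x (c *: y + z) = c *: mul x y + mul x z.
Proof. by rewrite linearDr linearZr. Qed.

Lemma precP1 c x y z : prec (c *: x + y) z = c *: prec x z + prec y z.
Proof. by rewrite linearDl linearZl. Qed.

Lemma cop_mul x y : cop (mul x y) = tmul (cop x) (cop y).
Proof.
move: x; apply: fo_span => [c u v eu ev|F].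
  by rewrite mulP1 !(linearP cop) eu ev tbilDl tbilZl.
move: y; apply: fo_span => [c u v eu ev|G].
  by rewrite mulP2 !(linearP cop) eu ev tbilDr tbilZr.
rewrite -fo_cat; elim: F => [|t F IH] /=.
  by rewrite fo_nil cop_one tmul1.
by rewrite cop_cons IH tmulA -cop_cons.
Qed.

Lemma cop_B d x : cop (B d x) = B d x \ot one + graft d (cop x).
Proof.
move: x; apply: fo_span => [c u v eu ev|F].
  rewrite (linearP (B d)) !(linearP cop) eu ev tenDl tenZl tensmapP.
  by rewrite [in RHS]addrACA -scalerDr.
rewrite B_fo cop_tree.
rewrite (sum_node_cuts d F (fun p r => fo p \ot fo r)) fo_nil.
rewrite cop_fo tensmap_sum; congr (_ + _); apply: eq_bigr => cs _.
by rewrite tensmapE B_fo.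
Qed.

(** * Induction over forests *)

(** A tree is grafted from the forest of the subtrees at its root, hence every
    forest is reached from the empty one by grafting and adding a tree on the
    left. *)
Lemma forest_ind (P : seq (ptree D) -> Prop) :
  P [::] -> (forall d G F, P G -> P F -> P (PNode d G :: F)) -> forall F, P F.
Proof.
move=> P0 PS; elim=> // t F; elim/ptree_ind': t F => d G IH F PF.
apply: PS => //; elim: G IH => //= t G IHG [IHt /IHG]; exact: IHt.
Qed.

Lemma graft_mul_ind (P : H -> Prop) :
    (forall c x y, P x -> P y -> P (c *: x + y)) -> P one ->
    (forall d x y, P x -> P y -> P (mul (B d x) y)) ->
  forall x, P x.
Proof.
move=> PL P1 PM; apply: fo_span => //.
elim/forest_ind => [|d G F PG PF]; first by rewrite fo_nil.
by rewrite -cat1s fo_cat -B_fo; apply: PM.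
Qed.

Lemma iota_projK x : x = eps x *: one + iota (proj x).
Proof. by rewrite iota_proj addrC subrK. Qed.

Lemma eps_one : eps one = 1.
Proof. by rewrite -fo_nil eps_fo. Qed.

Lemma eps_iota v : eps (iota v) = 0.
Proof.
have := iota_projK (iota v); rewrite iotaK => /eqP.
rewrite -subr_eq0 opprD addrCA subrr addr0 oppr_eq0 => /eqP e0.
have := epsP (eps (iota v)) one 0; rewrite addr0 e0.
have -> : eps 0 = 0.
  by have := epsP (-1) 0 0; rewrite scaler0 addr0 mulN1r addNr.
by rewrite addr0 eps_one mulr1.
Qed.

Lemma proj_one : proj one = 0.
Proof.
by rewrite -[proj one]iotaK iota_proj eps_one scale1r subrr linear0.
Qed.

Lemma iota_proj0 x : eps x = 0 -> iota (proj x) = x.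
Proof. by move=> e0; rewrite iota_proj e0 scale0r subr0. Qed.

Lemma eps_mul x y : eps (mul x y) = eps x * eps y.
Proof.
move: x; apply: fo_span => [c u v eu ev|F].
  by rewrite mulP1 !epsP eu ev mulrDl mulrA.
move: y; apply: fo_span => [c u v eu ev|G].
  by rewrite mulP2 !epsP eu ev mulrDr mulrCA.
by rewrite -fo_cat !eps_fo; case: F G => [|? ?] [|? ?]; rewrite ?mul1r ?mul0r.
Qed.

Lemma eps_B d x : eps (B d x) = 0.
Proof.
move: x; apply: fo_span => [c u v eu ev|F].
  by rewrite (linearP (B d)) epsP eu ev mulr0 addr0.
by rewrite B_fo eps_fo.
Qed.

(** In the product, y may be replaced by its component in the augmentation
    ideal, since its scalar component is dealt with by the grafting case. *)
Lemma augmented_ind (P : H -> Prop) :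
    (forall c x y, P x -> P y -> P (c *: x + y)) -> P one ->
    (forall d x, P x -> P (B d x)) ->
    (forall d x v, P (B d x) -> P (iota v) -> P (mul (B d x) (iota v))) ->
  forall x, P x.
Proof.
move=> PL P1 PB PM; apply: graft_mul_ind => // d x y Px Py.
rewrite [y]iota_projK mulP2 mulx1; apply: (PL); first exact: PB.
apply: PM; first exact: PB.
by rewrite iota_proj addrC -scaleNr; apply: PL.
Qed.

(** * Splitting the coproduct at the rightmost leaf *)

Lemma trunk_one : trunk one = one \ot one.
Proof. by rewrite -fo_nil trunk_fo /= fo_nil. Qed.

Lemma trunk_B d x : trunk (B d x) = graft d (trunk x).
Proof.
move: x; apply: fo_span => [c x y ex ey|F].
  by rewrite (linearP (B d)) !(linearP trunk) ex ey tensmapP.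
by rewrite B_fo !trunk_fo.
Qed.

Lemma trunk_mul x v : trunk (mul x (iota v)) = tmul (cop x) (trunk (iota v)).
Proof.
rewrite -[v]iotaK; move: (iota v); apply: fo_span => [c y z ey ez|F].
  rewrite (linearP proj) (linearP iota) mulP2 !(linearP trunk) ey ez.
  by rewrite tbilDr tbilZr.
case: F => [|t F].
  by rewrite fo_nil proj_one (linear0 iota) linear0r !(linear0 trunk) tbil0r.
rewrite iota_proj0 ?eps_fo //.
move: x; apply: fo_span => [c y z ey ez|G].
  by rewrite mulP1 (linearP trunk) (linearP cop) ey ez tbilDl tbilZl.
rewrite -fo_cat; elim: G => [|t' G IH].
  by rewrite fo_nil cop_one tmul1.
rewrite cop_cons -tmulA -IH !trunk_fo /=.
by case: G {IH}.
Qed.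

(** X_(a,b): the cuts leaving the rightmost leaf in the trunk have weight a, the
    other ones weight b.  By convention the only cut of the empty forest is of
    the first kind. *)
Definition wcop a b : H -> HH := locked_with tensor_key
  (fun x => a *: trunk x + b *: (cop x - trunk x)).

Lemma wcopE a b x : wcop a b x = a *: trunk x + b *: (cop x - trunk x).
Proof. by rewrite /wcop unlock. Qed.

Fact wcop_linear a b : linear (wcop a b).
Proof. by rewrite /wcop unlock; apply: linear_weighted. Qed.
HB.instance Definition _ a b :=
  GRing.isLinear.Build K H HH *:%R (wcop a b) (wcop_linear a b).

Lemma wcopP a b c x y :
  wcop a b (c *: x + y) = c *: wcop a b x + wcop a b y.
Proof. exact: linearP. Qed.
Lemma wcopD a b x y : wcop a b (x + y) = wcop a b x + wcop a b y.
Proof. exact: linearD. Qed.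
Lemma wcopB a b x y : wcop a b (x - y) = wcop a b x - wcop a b y.
Proof. exact: linearB. Qed.

Lemma wcop_const a x : wcop a a x = a *: cop x.
Proof. by rewrite !wcopE -scalerDr addrC subrK. Qed.

Lemma wcop_one a b : wcop a b one = a *: (one \ot one).
Proof. by rewrite !wcopE trunk_one cop_one subrr scaler0 addr0. Qed.

Lemma wcop_B a b d x :
  wcop a b (B d x) = b *: (B d x \ot one) + graft d (wcop a b x).
Proof.
rewrite !wcopE trunk_B cop_B tensmapD !tensmapZ tensmapB.
by rewrite -addrA scalerDr addrCA.
Qed.

Lemma wcop_mul a b x v :
  wcop a b (mul x (iota v)) = tmul (cop x) (wcop a b (iota v)).
Proof. by rewrite !wcopE trunk_mul cop_mul tbilDr !tbilZr tbilBr. Qed.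

(** * Counit axioms *)

Definition unitc x : H := eps x *: one.

Fact unitc_linear : linear unitc.
Proof. by move=> c x y; rewrite /unitc epsP scalerDl scalerA. Qed.
HB.instance Definition _ := GRing.isLinear.Build K H H *:%R unitc unitc_linear.

Lemma unitc_one : unitc one = one.
Proof. by rewrite /unitc eps_one scale1r. Qed.

Lemma unitc_B d x : unitc (B d x) = 0.
Proof. by rewrite /unitc eps_B scale0r. Qed.

Lemma unitc_mul x y : unitc (mul x y) = mul (unitc x) (unitc y).
Proof. by rewrite /unitc eps_mul linearZl linearZr /= mul1x scalerA. Qed.

Lemma tmul_unitcl s u : tensmap unitc idfun (tmul s u)
  = tmul (tensmap unitc idfun s) (tensmap unitc idfun u).
Proof.
elim/tensor_ind: s => [|x x' s IHs]; first by rewrite !(tbil0l, tensmap0).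
rewrite !(tbilDl, tensmapD) IHs; apply: eq_addl => {s IHs}.
elim/tensor_ind: u => [|y y' u IHu]; first by rewrite !(tbil0r, tensmap0).
rewrite !(tbilDr, tensmapD) IHu; apply: eq_addl => {u IHu}.
by rewrite !(tbilE, tensmapE) /= unitc_mul.
Qed.

Lemma tmul_unitcr s u : tensmap idfun unitc (tmul s u)
  = tmul (tensmap idfun unitc s) (tensmap idfun unitc u).
Proof.
elim/tensor_ind: s => [|x x' s IHs]; first by rewrite !(tbil0l, tensmap0).
rewrite !(tbilDl, tensmapD) IHs; apply: eq_addl => {s IHs}.
elim/tensor_ind: u => [|y y' u IHu]; first by rewrite !(tbil0r, tensmap0).
rewrite !(tbilDr, tensmapD) IHu; apply: eq_addl => {u IHu}.
by rewrite !(tbilE, tensmapE) /= unitc_mul.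
Qed.

Lemma cop_weight x : cop x = wcop 1 1 x.
Proof. by rewrite wcop_const scale1r. Qed.

(** The only cut with empty P^c is the empty cut, which leaves the rightmost
    leaf in the trunk. *)
Lemma wcop_counitl a b x :
  tensmap unitc idfun (wcop a b x) = a *: (one \ot x).
Proof.
move: x a b; apply: augmented_ind
  => [c x y ex ey a b|a b|d x IH a b|d x v IHB IHv a b].
- rewrite wcopP tensmapP ex ey tenDr tenZr.
  by rewrite scalerDr !scalerA mulrC.
- by rewrite wcop_one tensmapZ tensmapE /= unitc_one.
- rewrite wcop_B tensmapD tensmapZ tensmapE /= unitc_B ten0l scaler0 add0r.
  rewrite (tensmap_comp (f'' := unitc) (g'' := B d)) //.
  rewrite -(tensmap_comp (f := unitc) (g := idfun)
    (f' := idfun) (g' := B d)) //.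
  by rewrite IH tensmapZ tensmapE.
- rewrite wcop_mul tmul_unitcl cop_weight IHB IHv scale1r.
  by rewrite tbilZr tbilE mul1x.
Qed.

(** The only cut with empty R^c is the total cut, of weight b except on the
    empty forest, where it is also the empty cut. *)
Lemma wcop_counitr_gen a b x : tensmap idfun unitc (wcop a b x)
  = b *: (x \ot one) + ((a - b) * eps x) *: (one \ot one).
Proof.
move: x a b; apply: augmented_ind
  => [c x y ex ey a b|a b|d x IH a b|d x v IHB IHv a b].
- rewrite wcopP tensmapP ex ey tenDl tenZl epsP.
  rewrite mulrDr mulrCA scalerDl -[(c * _) *: _]scalerA.
  exact: scaler_lincomb.
- rewrite wcop_one tensmapZ tensmapE /= unitc_one eps_one mulr1 -scalerDl.
  by rewrite addrC subrK.
- rewrite wcop_B tensmapD tensmapZ tensmapE /= unitc_one.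
  rewrite (tensmap_comp (f'' := idfun) (g'' := unitc \o B d)) //.
  rewrite tensmap_eq0 ?eps_B ?mulr0 ?scale0r // => y /=.
  exact: unitc_B.
- rewrite wcop_mul tmul_unitcr cop_weight IHB IHv subrr mul0r eps_iota.
  rewrite !mulr0 !scale0r.
  by rewrite eps_mul eps_iota !mulr0 !scale0r !addr0 scale1r tbilZr tbilE mul1x.
Qed.

Lemma wcop_counitr a b v :
  tensmap idfun unitc (wcop a b (iota v)) = b *: (iota v \ot one).
Proof. by rewrite wcop_counitr_gen eps_iota mulr0 scale0r addr0. Qed.

(** * Coproducts of dendriform products *)

Definition succ x y : H := mul x y - prec x y.

Fact succ_bilinear : bilinear_for *:%R *:%R succ.
Proof.
split=> [z c x y|z c x y] /=; rewrite /succ.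
  by rewrite mulP1 precP1 opprD addrACA -scalerBr.
by rewrite mulP2 linearDr linearZr opprD addrACA -scalerBr.
Qed.
HB.instance Definition _ :=
  bilinear_isBilinear.Build K H H H *:%R *:%R succ succ_bilinear.

Local Notation tprec := (tbil mul prec).
Local Notation tsucc := (tbil mul succ).

Lemma tsuccE s u : tsucc s u = tmul s u - tprec s u.
Proof.
elim/tensor_ind: s => [|x x' s IHs]; first by rewrite !tbil0l subr0.
rewrite !tbilDl IHs opprD addrACA; apply: eq_addl => {s IHs}.
elim/tensor_ind: u => [|y y' u IHu]; first by rewrite !tbil0r subr0.
rewrite !tbilDr IHu opprD addrACA; apply: eq_addl => {u IHu}.
by rewrite !tbilE -tenBr.
Qed.

Lemma prec_B d x y : prec (B d x) y = B d (mul x y).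
Proof.
move: x; apply: fo_span => [c u v eu ev|F].
  by rewrite mulP1 !(linearP (B d)) precP1 eu ev.
by rewrite B_fo prec_cons fo_nil prec_one linear0r add0r mul1x subr0.
Qed.

Lemma prec_mul_B d x y z : prec (mul (B d x) y) z
  = mul (B d x) (prec y z) + B d (mul x (succ y z)).
Proof. by rewrite prec_mul prec_B. Qed.

Lemma tprec_one u : tprec (one \ot one) u = 0.
Proof.
elim/tensor_ind: u => [|x y u IH]; first by rewrite tbil0r.
by rewrite tbilDr IH tbilE prec_one ten0r addr0.
Qed.

Lemma tprec_mul_pure x s u :
  tprec (tmul (x \ot one) s) u = tmul (x \ot one) (tprec s u).
Proof.
elim/tensor_ind: s => [|y y' s IHs]; first by rewrite !(tbil0l, tbil0r).
rewrite !(tbilDl, tbilDr) IHs; apply: eq_addl => {s IHs}.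
elim/tensor_ind: u => [|z z' u IHu]; first by rewrite !tbil0r.
rewrite !tbilDr IHu; apply: eq_addl => {u IHu}.
by rewrite !tbilE mulA !mul1x.
Qed.

Lemma tprec_mul_graft d s1 s2 u : tprec (tmul (graft d s1) s2) u
  = tmul (graft d s1) (tprec s2 u) + graft d (tmul s1 (tsucc s2 u)).
Proof.
elim/tensor_ind: s1 => [|x x' s IHs].
  by rewrite !(tensmap0, tbil0l) addr0.
rewrite !(tbilDl, tensmapD) IHs addrACA; apply: eq_addl => {s IHs}.
elim/tensor_ind: s2 => [|y y' s IHs].
  by rewrite !(tbil0l, tbil0r, tensmap0) addr0.
rewrite !(tbilDl, tbilDr, tensmapD) IHs addrACA; apply: eq_addl => {s IHs}.
elim/tensor_ind: u => [|z z' s IHs].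
  by rewrite !(tbil0r, tensmap0) addr0.
rewrite !(tbilDr, tensmapD) IHs addrACA; apply: eq_addl => {s IHs}.
by rewrite !(tbilE, tensmapE) prec_mul_B tenDr !mulA.
Qed.

Lemma tmul_graft_pure d s x :
  tmul (graft d s) (x \ot one) = graft d (tmul s (x \ot one)).
Proof.
elim/tensor_ind: s => [|y y' s IHs].
  by rewrite !(tbil0l, tensmap0, tbil0l).
by rewrite !(tbilDl, tensmapD, tbilDl) IHs !(tensmapE, tbilE, tensmapE) !mulx1.
Qed.

(** Expanding Delta(x) prec X(y) with the conventions 1 prec y = 0 and
    y prec 1 = y for y in the augmentation ideal leaves 1 prec 1 undefined.
    Here it is 0, hence the term with weight b, which accounts for the total
    cut. *)
Lemma wcop_prec a b x v : wcop a b (prec x (iota v))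
  = b *: (prec x (iota v) \ot one) + tprec (cop x) (wcop a b (iota v)).
Proof.
set y := iota v; set W := wcop a b y.
move: x; apply: graft_mul_ind => [c x x' ex ex'||d g f _ ef].
- rewrite precP1 wcopP ex ex' (linearP cop) tbilDl tbilZl.
  rewrite tenDl tenZl; exact: scaler_lincomb.
- by rewrite prec_one linear0 ten0l scaler0 cop_one tprec_one addr0.
(* For x = B_d(g) f the definition of prec reads
   x prec y = B_d(g) (f prec y) + B_d (g (f succ y)). *)
set P := prec f y in ef *; set S := succ f y.
have iP : iota (proj P) = P by rewrite iota_proj0 ?eps_prec.
have iS : iota (proj S) = S.
  rewrite /S /succ -/P (linearB proj) (linearB iota) iP iota_proj0 //.
  by rewrite eps_mul eps_iota mulr0.
set T := tsucc (cop f) W; set Q := tprec (cop f) W in ef *.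
have eS : wcop a b S = T - b *: (P \ot one).
  by rewrite /S /succ wcopB wcop_mul ef /T tsuccE; apply: subr_swap.
have eP : wcop a b (mul (B d g) P)
    = b *: (mul (B d g) P \ot one) + b *: graft d (tmul (cop g) (P \ot one))
      + tmul (cop (B d g)) Q.
  rewrite -[in LHS]iP wcop_mul iP ef cop_B !tbilDr !tbilDl !tbilZr tbilE mul1x.
  by rewrite tmul_graft_pure.
have eB : wcop a b (B d (mul g S)) = b *: (B d (mul g S) \ot one)
    + (graft d (tmul (cop g) T) - b *: graft d (tmul (cop g) (P \ot one))).
  rewrite wcop_B -[in X in _ + X]iS wcop_mul iS eS tbilBr tbilZr.
  by rewrite tensmapB tensmapZ.
rewrite prec_mul_B -/P -/S wcopD eP eB cop_mul.
rewrite [cop (B d g)]cop_B !tbilDl tprec_mul_pure tprec_mul_graft -/Q -/T.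
rewrite tenDl scalerDr; exact: addr_cancel_mid.
Qed.

Lemma wcop_succ a b x v : wcop a b (succ x (iota v))
  = tsucc (cop x) (wcop a b (iota v)) - b *: (prec x (iota v) \ot one).
Proof. by rewrite wcopB wcop_mul wcop_prec tsuccE; apply: subr_swap. Qed.

(** * Coassociativity *)

Local Notation tmul3 := (tbil mul (tbil mul mul)).
Local Notation coassl f := (fun s => tensassoc (tensmap f (@idfun H) s)).
Local Notation coassr f := (tensmap (@idfun H) f).
Local Notation attach x := (tensmap (@idfun H) (applyr (@ten K H H) x)).

Lemma attach_tmul s1 s2 x y :
  attach (mul x y) (tmul s1 s2) = tmul3 (attach x s1) (attach y s2).
Proof. by apply: tensmap_tbil_morph => // u v; rewrite /= tbilE. Qed.

(** In X(xy) = Delta(x) X(y) the element y must be in the augmentation ideal.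
    Before applying this to a factor of X(v), the component of that factor along
    the unit is separated; coassl_unit and coassr_unit deal with it. *)
Lemma wcop_split_left a b v : wcop a b (iota v)
  = a *: (one \ot iota v)
    + tensmap iota idfun (tensmap proj idfun (wcop a b (iota v))).
Proof.
rewrite (tensmap_comp (f'' := iota \o proj) (g'' := idfun)) //.
rewrite (@tensmapBl _ _ _ _ _ _ idfun unitc) => [|x]; last exact: iota_proj.
by rewrite tensmap_id wcop_counitl addrC subrK.
Qed.

Lemma wcop_split_right a b v : wcop a b (iota v)
  = b *: (iota v \ot one)
    + tensmap idfun iota (tensmap idfun proj (wcop a b (iota v))).
Proof.
rewrite (tensmap_comp (f'' := idfun) (g'' := iota \o proj)) //.
rewrite (@tensmapBr _ _ _ _ _ _ _ idfun unitc) => [|x]; last exact: iota_proj.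
by rewrite tensmap_id wcop_counitr addrC subrK.
Qed.

Lemma coassl_mul a b s (t : (A \ox H)%type) :
  coassl (wcop a b) (tmul s (tensmap iota idfun t))
  = tmul3 (coassl cop s) (coassl (wcop a b) (tensmap iota idfun t)).
Proof.
elim/tensor_ind: s => [|u u' s IH].
  by rewrite !(tbil0l, tensmap0, tensassoc0).
rewrite !(tbilDl, tensmapD, tensassocD) IH; apply: eq_addl => {s IH}.
elim/tensor_ind: t => [|v v' t IH].
  by rewrite !(tbil0r, tensmap0, tensassoc0, tbil0r).
rewrite !(tbilDr, tensmapD, tensassocD) IH; apply: eq_addl => {t IH}.
rewrite !(tensmapE, tbilE) /= wcop_mul.
by rewrite !tensassoc_pure attach_tmul.
Qed.

Lemma coassr_mul a b s (t : (H \ox A)%type) :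
  coassr (wcop a b) (tmul s (tensmap idfun iota t))
  = tmul3 (coassr cop s) (coassr (wcop a b) (tensmap idfun iota t)).
Proof.
elim/tensor_ind: s => [|u u' s IH].
  by rewrite !(tbil0l, tensmap0, tbil0l).
rewrite !(tbilDl, tensmapD) IH; apply: eq_addl => {s IH}.
elim/tensor_ind: t => [|v v' t IH].
  by rewrite !(tbil0r, tensmap0, tbil0r).
rewrite !(tbilDr, tensmapD) IH; apply: eq_addl => {t IH}.
by rewrite !(tensmapE, tbilE) /= wcop_mul.
Qed.

(** The hypothesis says that c = 0 or a = b. *)
Lemma scale_wcop a b c x : c * a = c * b -> c *: wcop a b x = (c * a) *: cop x.
Proof.
move=> e; rewrite !wcopE scalerDr !scalerA -e -scalerDr.
by rewrite addrC subrK.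
Qed.

Lemma coassl_unit a b c s x : c * a = c * b ->
  coassl (wcop a b) (tmul s (c *: (one \ot x)))
  = tmul3 (coassl cop s) (coassl (wcop a b) (c *: (one \ot x))).
Proof.
move=> e; elim/tensor_ind: s => [|u u' s IH].
  by rewrite !(tbil0l, tensmap0, tensassoc0).
rewrite !(tbilDl, tensmapD, tensassocD) IH; apply: eq_addl => {s IH}.
rewrite !(tbilZr, tensmapZ, tensassocZ, tbilE, tensmapE) /= mulx1.
rewrite !tensassoc_pure -tensmapZ scale_wcop // wcop_one tensmapZ.
by rewrite -attach_tmul tbilZr tmulx1 tensmapZ scalerA.
Qed.

Lemma coassr_unit a b c s x : c * a = c * b ->
  coassr (wcop a b) (tmul s (c *: (x \ot one)))
  = tmul3 (coassr cop s) (coassr (wcop a b) (c *: (x \ot one))).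
Proof.
move=> e; elim/tensor_ind: s => [|u u' s IH].
  by rewrite !(tbil0l, tensmap0, tbil0l).
rewrite !(tbilDl, tensmapD) IH; apply: eq_addl => {s IH}.
rewrite !(tbilZr, tensmapZ, tbilE, tensmapE) /= mulx1.
rewrite -tenZr scale_wcop // wcop_one tbilZr tmulx1 !tenZr scalerA.
by [].
Qed.

Lemma coassl_wcop_mul a b c e x v : c * a = c * b ->
  coassl (wcop a b) (wcop c e (mul x (iota v)))
  = tmul3 (coassl cop (cop x)) (coassl (wcop a b) (wcop c e (iota v))).
Proof.
move=> h; rewrite wcop_mul wcop_split_left tbilDr !tensmapD !tensassocD.
rewrite [in RHS]tbilDr; apply: eq_add2; first exact: coassl_unit.
exact: coassl_mul.
Qed.

Lemma coassr_wcop_mul a b c e x v : e * a = e * b ->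
  coassr (wcop a b) (wcop c e (mul x (iota v)))
  = tmul3 (coassr cop (cop x)) (coassr (wcop a b) (wcop c e (iota v))).
Proof.
move=> h; rewrite wcop_mul wcop_split_right tbilDr !tensmapD.
rewrite [in RHS]tbilDr; apply: eq_add2; first exact: coassr_unit.
exact: coassr_mul.
Qed.

Lemma attach_graft d s x :
  attach (B d x) s = tensmap idfun (graft d) (attach x s).
Proof. by symmetry; apply: tensmap_comp => // y; exact: tensmapE. Qed.

Lemma coassl_graft d a b s : coassl (wcop a b) (graft d s)
  = tensmap idfun (graft d) (coassl (wcop a b) s).
Proof.
elim/tensor_ind: s => [|u u' s IH].
  by rewrite !(tensmap0, tensassoc0).
rewrite !(tensmapD, tensassocD) IH !tensmapE /=; apply: eq_addl.
by rewrite !tensassoc_pure attach_graft.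
Qed.

Lemma coassr_graft d a b s : coassr (wcop a b) (graft d s)
  = b *: attach one (graft d s) + tensmap idfun (graft d) (coassr (wcop a b) s).
Proof.
elim/tensor_ind: s => [|u u' s IH].
  by rewrite !tensmap0 scaler0 add0r.
rewrite !tensmapD IH scalerDr addrACA; apply: eq_addl.
by rewrite !tensmapE /= wcop_B tenDr tenZr.
Qed.

(** Both sides sum over the double cuts of a forest into three pieces, with a
    weight that depends on the piece containing the rightmost leaf:
    - third piece: c on the left, where the first two pieces are then separated
      without regard to the leaf, so that a and b must agree unless c = 0, and
      c' a' on the right;
    - second piece: e a on the left and c' b' on the right;
    - first piece: e b on the left and e' on the right, where the last two
      pieces are separated without regard to the leaf, so that a' and b' must
      agree unless e' = 0.
    The hypotheses are these equalities.  They hold when all the weights are 1,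
    which is coassociativity of Delta and is used in the inductive step. *)
Lemma wcop_coassoc a b c e a' b' c' e' x :
    c * a = c' * a' -> c * a = c * b ->
    e * b = e' * a' -> e * b = e' * b' -> e * b = b' * e' -> e * a = b' * c' ->
  coassl (wcop a b) (wcop c e x) = coassr (wcop a' b') (wcop c' e' x).
Proof.
move: x a b c e a' b' c' e'; apply: augmented_ind
  => [k x y ex ey a b c e a' b' c' e' *|a b c e a' b' c' e' h0 *
     |d x IH a b c e a' b' c' e' h0 h1 h2 h3 h4 h5
     |d x v IHB IHv a b c e a' b' c' e' h0 h1 h2 h3 h4 h5].
- by rewrite !wcopP !tensmapP tensassocP (ex _ _ _ _ a' b' c' e') //
    (ey _ _ _ _ a' b' c' e').
- rewrite !wcop_one !tensmapZ !tensmapE /= !wcop_one tensassocZ tenZl tenZr.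
  by rewrite tensassocZ tensassocE !scalerA h0.
- rewrite ![wcop _ _ (B d x)]wcop_B !tensmapD !tensmapZ !tensmapE /=.
  rewrite tensassocD tensassocZ coassl_graft coassr_graft.
  rewrite (IH _ _ _ _ a' b' c' e') // addrA; apply: eq_addl.
  rewrite wcop_B tensassoc_pure tensmapD tensmapZ tensmapE /= wcop_one.
  rewrite tenZr scalerDr !scalerA h2.
  have key : e *: wcop a b x = b' *: wcop c' e' x.
    by rewrite 2!wcopE; apply: eq_scale_comb.
  apply: eq_add2; first by [].
  transitivity (attach one (graft d (e *: wcop a b x))).
    by rewrite !tensmapZ.
  by rewrite key !tensmapZ.
- rewrite coassl_wcop_mul // coassr_wcop_mul; last by rewrite -h2 -h3.
  rewrite (IHv _ _ _ _ a' b' c' e') //.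
  have := IHB 1 1 1 1 1 1 1 1 erefl erefl erefl erefl erefl erefl.
  rewrite -cop_weight (eq_tensmap (f' := cop) (g' := idfun)) // => [->|y].
    rewrite (eq_tensmap (f' := idfun) (g' := cop)) // => y.
    by rewrite cop_weight.
  by rewrite cop_weight.
Qed.

(** * Half coproducts of the augmentation ideal *)

Definition redcop a b v := tensmap proj proj (wcop a b (iota v)).

Lemma wcop_decomp a b v : wcop a b (iota v)
  = a *: (one \ot iota v) + b *: (iota v \ot one)
    + tensmap iota iota (redcop a b v).
Proof.
rewrite {1}wcop_split_left {1}wcop_split_right -addrA.
rewrite !tensmapD !tensmapZ !tensmapE /= iotaK.
rewrite (tensmap_comp (f'' := proj) (g'' := iota)) //.
rewrite (tensmap_comp (f'' := proj) (g'' := iota \o proj)) //.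
rewrite (tensmap_comp (f'' := iota \o proj) (g'' := iota \o proj)) //.
by rewrite /redcop (tensmap_comp (f'' := iota \o proj) (g'' := iota \o proj)).
Qed.

Section Compatibility.
Variables (n : {bilinear H -> H -> H}) (mA nA : {bilinear A -> A -> A}).
Variables n1 n2 : {linear A -> A}.
Hypothesis mAE : forall v w, proj (mul (iota v) (iota w)) = mA v w.
Hypothesis nAE : forall v w, proj (n (iota v) (iota w)) = nA v w.
Hypothesis n1E : forall w, proj (n one (iota w)) = n1 w.
Hypothesis n2E : forall v, proj (n (iota v) one) = n2 v.
Hypothesis n_one : proj (n one one) = 0.

(** Delta(v) and X(w) are sums of a reduced part and of two terms having the
    unit as one factor (wcop_decomp).  In the expansion the terms that keep the
    unit as a factor are killed by proj; n1 and n2 are the operations that n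
    induces when one of its arguments is the unit. *)
Lemma proj_product a b v w :
  tensmap proj proj (tbil mul n (cop (iota v)) (wcop a b (iota w)))
  = tbil mA nA (redcop 1 1 v) (redcop a b w)
    + a *: tensmap idfun (applyr nA w) (redcop 1 1 v)
    + b *: tensmap (applyr mA w) n2 (redcop 1 1 v)
    + tensmap idfun (nA v) (redcop a b w)
    + tensmap (mA v) n1 (redcop a b w)
    + a *: (v \ot n1 w) + b *: (w \ot n2 v).
Proof.
rewrite cop_weight (wcop_decomp 1 1) (wcop_decomp a b) !scale1r.
set Dv := redcop 1 1 v; set Dw := redcop a b w.
rewrite !tbilDl !tbilDr !tensmapD !tbilZr 6!tensmapZ !tbilE !tensmapE /=.
rewrite !mul1x !mulx1 !iotaK proj_one ten0l n_one ten0r !scaler0 n1E n2E.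
rewrite (tensmap_tbil (m' := mA) (n' := nA)) //.
rewrite (tensmap_tbil_purel (p := idfun) (q := nA v)) //; last first.
  by move=> y; rewrite mul1x iotaK.
rewrite (tensmap_tbil_purel (p := mA v) (q := n1)) //.
rewrite (tensmap_tbil_purer (p := idfun) (q := applyr nA w)) //; last first.
  by move=> y; rewrite mulx1 iotaK.
rewrite (tensmap_tbil_purer (p := applyr mA w) (q := n2)) //.
exact: addr_expand9.
Qed.

End Compatibility.

HB.instance Definition _ a b := GRing.Linear.copy (redcop a b)
  (tensmap proj proj \o wcop a b \o iota).

Lemma redcop_proj a b x : redcop a b (proj x) = tensmap proj proj (wcop a b x).
Proof.
rewrite /redcop iota_proj wcopB tensmapB [eps x *: one]/(unitc x).
have -> : wcop a b (unitc x) = eps x *: wcop a b one by exact: linearZ.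
by rewrite wcop_one !tensmapZ tensmapE proj_one ten0l !scaler0 subr0.
Qed.

Lemma redcop_coassoc a b c e a' b' c' e' v :
    c * a = c' * a' -> c * a = c * b ->
    e * b = e' * a' -> e * b = e' * b' -> e * b = b' * e' -> e * a = b' * c' ->
  tensassoc (tensmap (redcop a b) idfun (redcop c e v))
  = tensmap idfun (redcop a' b') (redcop c' e' v).
Proof.
move=> h0 h1 h2 h3 h4 h5; rewrite {2 4}/redcop.
pose pp : {linear HH -> (A \ox A)%type} := tensmap proj proj.
pose pl : {linear H -> (A \ox A)%type} := pp \o wcop a b.
pose pr : {linear H -> (A \ox A)%type} := pp \o wcop a' b'.
have El u : tensmap (redcop a b) idfun (tensmap proj proj u)
    = tensmap pp proj (tensmap (wcop a b) idfun u).
  transitivity (tensmap pl proj u).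
    by apply: tensmap_comp => // x; apply: redcop_proj.
  by symmetry; apply: tensmap_comp.
have Er u : tensmap idfun (redcop a' b') (tensmap proj proj u)
    = tensmap proj pp (tensmap idfun (wcop a' b') u).
  transitivity (tensmap proj pr u).
    by apply: tensmap_comp => // x; apply: redcop_proj.
  by symmetry; apply: tensmap_comp.
by rewrite El Er tensassoc_tensmap (wcop_coassoc _ h0 h1 h2 h3 h4 h5).
Qed.

Lemma redcop_add v : redcop 0 1 v + redcop 1 0 v = redcop 1 1 v.
Proof.
rewrite /redcop -tensmapD; congr (tensmap _ _ _).
by rewrite !wcopE !scale0r !scale1r add0r addr0 addrC.
Qed.

Lemma prec_x1 x : prec x one = iota (proj x).
Proof.
move: x; apply: graft_mul_ind => [c x y ex ey||d x y _ ey].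
- by rewrite precP1 ex ey (linearP proj) (linearP iota).
- by rewrite prec_one proj_one linear0.
have ys : succ y one = eps y *: one.
  by rewrite /succ ey iota_proj mulx1 subKr.
have mZ z : mul z (eps y *: one) = eps y *: z by rewrite linearZr /= mulx1.
rewrite prec_mul_B ey ys iota_proj linearBr !mZ (linearZ_LR (B d)) /=.
by rewrite subrK iota_proj0 // eps_mul eps_B mul0r.
Qed.

Lemma redcop_reduced v : tensmap iota iota (redcop 1 1 v)
  = cop (iota v) - iota v \ot one - one \ot iota v.
Proof.
rewrite cop_weight wcop_decomp !scale1r; exact: addr_peel.
Qed.

Definition bul d := proj (B d one).

Lemma iota_bul d : iota (bul d) = B d one.
Proof. by rewrite iota_proj0 ?eps_B. Qed.

Lemma redcop_bul a b d : redcop a b (bul d) = 0.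
Proof.
rewrite redcop_proj wcop_B wcop_one tensmapD !tensmapZ !tensmapE /=.
by rewrite proj_one ten0r ten0l !scaler0 addr0.
Qed.

Section Bidendriform.
Variables pA sA : {bilinear A -> A -> A}.
Hypothesis iota_pA : forall v w, iota (pA v w) = prec (iota v) (iota w).
Hypothesis iota_sA : forall v w, iota (sA v w) = succ (iota v) (iota w).

Let mA v w := pA v w + sA v w.

Let mA_bilinear : bilinear_for *:%R *:%R mA.
Proof.
split=> [w c v1 v2|w c v1 v2] /=; rewrite /mA.
  by rewrite !linearDl !linearZl scalerDr addrACA.
by rewrite !linearDr !linearZr scalerDr addrACA.
Qed.
HB.instance Definition _ :=
  bilinear_isBilinear.Build K A A A *:%R *:%R mA mA_bilinear.

Let zeroA : {linear A -> A} := \0.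

Let proj_mA v w : proj (mul (iota v) (iota w)) = mA v w.
Proof.
by rewrite -[RHS]iotaK (linearD iota) iota_pA iota_sA /succ addrC subrK.
Qed.

Let proj_pA v w : proj (prec (iota v) (iota w)) = pA v w.
Proof. by rewrite -iota_pA iotaK. Qed.

Let proj_sA v w : proj (succ (iota v) (iota w)) = sA v w.
Proof. by rewrite -iota_sA iotaK. Qed.

Lemma redcop_prec a b v w : redcop a b (pA v w)
  = tbil mA pA (redcop 1 1 v) (redcop a b w)
    + a *: tensmap idfun (applyr pA w) (redcop 1 1 v)
    + b *: tensmap (applyr mA w) idfun (redcop 1 1 v)
    + tensmap idfun (pA v) (redcop a b w) + b *: (w \ot v).
Proof.
rewrite /redcop iota_pA wcop_prec tensmapD tensmapZ tensmapE proj_one ten0r.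
rewrite scaler0 add0r.
have p1 w' : proj (prec one (iota w')) = zeroA w'.
  by rewrite prec_one linear0.
have p2 v' : proj (prec (iota v') one) = idfun v' by rewrite prec_x1 !iotaK.
have p11 : proj (prec one one) = 0 by rewrite prec_one linear0.
rewrite (proj_product proj_mA proj_pA p1 p2 p11).
rewrite [tensmap _ zeroA _]tensmap_eq0 => [|//].
by rewrite ten0r scaler0 !addr0.
Qed.

Lemma redcop_succ a b v w : redcop a b (sA v w)
  = tbil mA sA (redcop 1 1 v) (redcop a b w)
    + a *: tensmap idfun (applyr sA w) (redcop 1 1 v)
    + tensmap idfun (sA v) (redcop a b w)
    + tensmap (mA v) idfun (redcop a b w) + a *: (v \ot w).
Proof.
rewrite /redcop iota_sA wcop_succ tensmapB tensmapZ tensmapE proj_one ten0r.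
rewrite scaler0 subr0.
have s1 w' : proj (succ one (iota w')) = idfun w'.
  by rewrite /succ prec_one mul1x subr0 iotaK.
have s2 v' : proj (succ (iota v') one) = zeroA v'.
  by rewrite /succ prec_x1 iotaK mulx1 subrr linear0.
have s11 : proj (succ one one) = 0.
  by rewrite /succ prec_one mul1x subr0 proj_one.
rewrite (proj_product proj_mA proj_sA s1 s2 s11).
rewrite [tensmap _ zeroA _]tensmap_eq0 => [|//].
by rewrite ten0r !scaler0 !addr0.
Qed.

Theorem redcop_bidendriform : dendriform_algebra pA sA ->
  bidendriform_bialgebra pA sA (redcop 0 1) (redcop 1 0).
Proof.
move=> dendA.
have Dt : (fun v => redcop 0 1 v + redcop 1 0 v) = redcop 1 1.
  by apply: funext => v; apply: redcop_add.
split=> //.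
- split; try exact: linearP.
  + move=> v; rewrite Dt.
    have := @redcop_coassoc 0 1 0 1 1 1 0 1 v.
    rewrite tensassoc_sweedler !tensmap_sweedler.
    by apply; rewrite ?(mul0r, mul1r).
  + move=> v.
    have := @redcop_coassoc 1 0 0 1 0 1 1 0 v.
    rewrite tensassoc_sweedler !tensmap_sweedler.
    by apply; rewrite ?(mul0r, mul1r).
  + move=> v; rewrite Dt.
    have := @redcop_coassoc 1 1 1 0 1 0 1 0 v.
    rewrite tensassoc_sweedler !tensmap_sweedler.
    by apply; rewrite ?(mul0r, mul1r).
- move=> v w m Dt'; rewrite redcop_succ -redcop_add !scale1r.
  by rewrite !tbil_sweedler !tensmap_sweedler tenE.
- move=> v w m Dt'; rewrite redcop_prec -redcop_add !scale1r !scale0r !addr0.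
  by rewrite !tbil_sweedler !tensmap_sweedler.
- move=> v w m Dt'; rewrite redcop_succ -redcop_add !scale0r !addr0 addrAC.
  by rewrite !tbil_sweedler !tensmap_sweedler.
- move=> v w m Dt'; rewrite redcop_prec -redcop_add !scale1r !scale0r !addr0.
  by rewrite !tbil_sweedler !tensmap_sweedler tenE.
Qed.

End Bidendriform.

(** * Uniqueness *)

Lemma B_decomp d x : B d x = eps x *: B d one + B d (iota (proj x)).
Proof. by rewrite [x in LHS]iota_projK linearP. Qed.

Section DendriformStructure.
Variables p s : A -> A -> A.
Hypothesis dendA : dendriform_algebra p s.
Hypothesis iota_mul : forall v w, iota (p v w + s v w) = mul (iota v) (iota w).
Hypothesis iota_bul_prec : forall d v, iota (p (bul d) v) = B d (iota v).

Let bp : {bilinear A -> A -> A} :=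
  HB.pack p (bilinear_isBilinear.Build K A A A *:%R *:%R p
    (dendri_bilinear_prec dendA)).
Let bs : {bilinear A -> A -> A} :=
  HB.pack s (bilinear_isBilinear.Build K A A A *:%R *:%R s
    (dendri_bilinear_succ dendA)).

Let pP c v w v' : p (c *: v + w) v' = c *: p v v' + p w v'.
Proof. exact: (dendri_bilinear_prec dendA).1. Qed.

Let p0 w : p 0 w = 0.
Proof. exact: (linear0l bp w). Qed.

Lemma proj_B_iota d v : proj (B d (iota v)) = p (bul d) v.
Proof. by rewrite -iota_bul_prec iotaK. Qed.

Lemma proj_mul_iota v w : proj (mul (iota v) (iota w)) = p v w + s v w.
Proof. by rewrite -iota_mul iotaK. Qed.

Lemma iota_succ_sub v w :
  iota (s v w) = mul (iota v) (iota w) - iota (p v w).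
Proof. by rewrite -iota_mul (linearD iota) addrAC subrr add0r. Qed.

(** The dendriform axioms and the value of prec on one-vertex trees force
    (B_d x) prec w = B_d(x w), and then the value of (B_d x) v prec w: as
    u v = u prec v + u succ v, it is u prec (v w) + u succ (v prec w) for
    u = B_d x, which is the recursion satisfied by the explicit product. *)
Lemma iota_prec v w : iota (p v w) = prec (iota v) (iota w).
Proof.
rewrite -[v]iotaK; move: (iota v) w; apply: augmented_ind => {v}
  [c x y ex ey w|w|d x _ w|d x v IHB IHv w].
- by rewrite (linearP proj) pP (linearP iota) ex ey (linearP iota) precP1.
- by rewrite proj_one p0 !linear0 linear0l.
- rewrite B_decomp (linearP proj) -/(bul d) proj_B_iota pP (linearP iota).
  rewrite (dendri_prec_prec dendA) !iota_bul_prec iota_mul (linearP iota).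
  by rewrite iota_bul iota_bul_prec precP1 !prec_B mul1x.
- rewrite iotaK in IHv; have := IHB; set u := proj (B d x).
  have uE : B d x = iota u by rewrite iota_proj0 ?eps_B.
  rewrite uE => IHu.
  rewrite proj_mul_iota -[in LHS](scale1r (p u v)) pP scale1r.
  rewrite (dendri_prec_prec dendA) (dendri_succ_prec dendA) (linearD iota).
  rewrite IHu iota_succ_sub IHu !iota_mul IHv prec_mul.
  by rewrite linearBr addrCA addrA.
Qed.

Lemma iota_succ v w : iota (s v w) = succ (iota v) (iota w).
Proof. by rewrite iota_succ_sub iota_prec. Qed.

(** The one-vertex trees generate, as B_d v is the product of the one-vertex
    tree by v for prec, and concatenation is prec + succ. *)
Lemma bul_gen_ind (P : A -> Prop) :
    (forall c v w, P v -> P w -> P (c *: v + w)) -> P 0 ->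
    (forall d, P (bul d)) -> (forall v w, P v -> P w -> P (p v w)) ->
    (forall v w, P v -> P w -> P (s v w)) ->
  forall v, P v.
Proof.
move=> PL P0 Pb Pp Ps v; rewrite -[v]iotaK; move: (iota v).
apply: augmented_ind => {v} [c x y Px Py||d x Px|d x v PB Pv].
- by rewrite (linearP proj); apply: PL.
- by rewrite proj_one.
- rewrite B_decomp (linearP proj) proj_B_iota.
  by apply: PL; [apply: Pb | apply: Pp; [apply: Pb|]].
- rewrite iotaK in Pv; have := PB; set u := proj (B d x) => Pu.
  have -> : B d x = iota u by rewrite iota_proj0 ?eps_B.
  rewrite proj_mul_iota -[p u v]scale1r.
  by apply: PL; [apply: Pp|apply: Ps].
Qed.

Lemma half_coproducts_unique Dp Ds Dp' Ds' :
    bidendriform_bialgebra p s Dp Ds -> bidendriform_bialgebra p s Dp' Ds' ->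
    (forall d, Dp (bul d) = Dp' (bul d)) ->
    (forall d, Ds (bul d) = Ds' (bul d)) ->
  forall v, Dp v = Dp' v /\ Ds v = Ds' v.
Proof.
move=> [_ [lp ls _ _ _] ss sp ps pp] [_ [lp' ls' _ _ _] ss' sp' ps' pp'].
move=> bp' bs'.
apply: bul_gen_ind => [c v w [pv sv] [pw sw]||d|v w [pv sv] [pw sw]
    |v w [pv sv] [pw sw]].
- by rewrite lp lp' ls ls' pv sv pw sw.
- have z (V W : lmodType K) (f : V -> W) : linear f -> f 0 = 0.
    move=> lf; have := lf (-1) 0 0.
    by rewrite !scaleN1r !addNr.
  by rewrite !z.
- by rewrite bp' bs'.
- by rewrite pp pp' sp sp' /= pv sv pw sw.
- by rewrite ps ps' ss ss' /= pv sv pw sw.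
Qed.

Theorem forest_bidendriform : exists Dp Ds : A -> A \ox A,
  [/\ bidendriform_bialgebra p s Dp Ds,
      forall v, tensmap iota iota (Dp v + Ds v)
        = cop (iota v) - iota v \ot one - one \ot iota v,
      forall d, Dp (bul d) = 0 /\ Ds (bul d) = 0
    & forall Dp' Ds', bidendriform_bialgebra p s Dp' Ds' ->
        (forall d, Dp' (bul d) = 0 /\ Ds' (bul d) = 0) ->
      Dp' =1 Dp /\ Ds' =1 Ds].
Proof.
have bb : bidendriform_bialgebra p s (redcop 0 1) (redcop 1 0).
  exact: (redcop_bidendriform (pA := bp) (sA := bs) iota_prec iota_succ dendA).
exists (redcop 0 1), (redcop 1 0); split=> //.
- by move=> v; rewrite redcop_add redcop_reduced.
- by move=> d; rewrite !redcop_bul.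
- move=> Dp' Ds' bb' b0.
  have U := half_coproducts_unique bb' bb.
  by split=> v; have [] := U _ _ v => // d; rewrite redcop_bul; case: (b0 d).
Qed.

End DendriformStructure.

End ForestModel.

(** * The bialgebra of planar forests *)

Section ForestAlgebra.
Variables (K : fieldType) (D : choiceType).
Local Notation HD := (forest_algebra K D).
Local Notation AD := (AD K D).
Local Notation fo := (forest K).
Implicit Types (d : D) (F G : seq (ptree D)) (x y z : HD).

Lemma forest_cat F G : fo (F ++ G) = fo F * fo G :> HD.
Proof.
rewrite /forest [RHS]malgM_def fgmulUU mulr1; congr (<< _ >>).
by apply/eqP; rewrite fmP fmM.
Qed.

Lemma forest_nil : fo [::] = 1 :> HD.
Proof. by rewrite /forest -fmoneE. Qed.

Lemma forest_span_ind (P : HD -> Prop) :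
    (forall c x y, P x -> P y -> P (c *: x + y)) ->
  (forall F, P (fo F)) -> forall x, P x.
Proof.
move=> PL PF x; rewrite [x]monalgE.
elim: (enum_fset _) => [|k s IHs].
  rewrite big_nil -(addNr (fo [::] : HD)) -scaleN1r.
  exact: PL.
rewrite big_cons -[x@_k]mulr1 -malgZU; apply: PL => //.
by case: k => F; apply: PF.
Qed.

(** Forests do not commute, so the module structure is only that of a left
    algebra; scalars are nevertheless central. *)
Lemma hmul_scaler c x y : x * (c *: y) = c *: (x * y).
Proof.
rewrite -[c *: y]mul_malgC mulrA scalerAl; congr (_ * _).
rewrite malgM_def fgmulgU malgZ_def; apply: eq_bigr => k _.
by rewrite mulrC mulm1.
Qed.

Lemma hmul_bilinear : bilinear_for *:%R *:%R (fun x y => x * y).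
Proof.
split=> [z c x y|z c x y] /=; first by rewrite mulrDl scalerAl.
by rewrite mulrDr hmul_scaler.
Qed.

Definition hmul x y : HD := x * y.
HB.instance Definition _ :=
  bilinear_isBilinear.Build K HD HD HD *:%R *:%R hmul hmul_bilinear.

HB.instance Definition _ d :=
  GRing.isLinear.Build K HD HD *:%R (@Bplus K D d) (linext_is_linear _).

HB.instance Definition _ :=
  GRing.isLinear.Build K HD (HD \ox HD)%type *:%R (@coprod K D)
    (linext_is_linear _).

HB.instance Definition _ := bilinear_isBilinear.Build K HD HD HD *:%R *:%R
  (@hprec K D) (conj (@hprec_linearl K D) (@hprec_linearr K D)).

Lemma Bplus_forest d F : Bplus d (fo F) = fo [:: PNode d F] :> HD.
Proof. by rewrite /Bplus linextU. Qed.

Lemma coprod_forest F : coprod (fo F) =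
  \sum_(c <- adm_cuts_forest F) (fo (forest_P F c) \ot fo (forest_R F c)).
Proof.
by rewrite /coprod linextU; apply: eq_bigr => c _; rewrite tenE.
Qed.

Lemma counitP c x y : counit (c *: x + y) = c * counit x + counit y.
Proof. by rewrite /counit mcoeffD mcoeffZ. Qed.

Lemma counit1 : counit (1 : HD) = 1.
Proof. by rewrite -forest_nil counit_forest. Qed.

Lemma proj_subproof x : x - counit x *: 1 \in @counit_ker K D.
Proof. by rewrite unfold_in -scaleNr addrC counitP counit1 mulr1 addNr. Qed.

Definition proj x : AD := MkAD (proj_subproof x).

Lemma proj_linear : linear proj.
Proof.
move=> c x y; apply: val_inj; rewrite /= counitP.
by rewrite scalerDl opprD addrACA scalerBr scalerA.
Qed.

HB.instance Definition _ := GRing.isLinear.Build K HD AD *:%R proj proj_linear.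

Lemma adval_linear : linear (@adval K D).
Proof. by []. Qed.

HB.instance Definition _ :=
  GRing.isLinear.Build K AD HD *:%R (@adval K D) adval_linear.

Lemma advalK : cancel (@adval K D) proj.
Proof.
case=> x kx; apply: val_inj; rewrite /=.
by move: kx => /eqP ->; rewrite scale0r subr0.
Qed.

Lemma adval_proj x : adval (proj x) = x - counit x *: 1.
Proof. by []. Qed.

Lemma hprec_forest F y : hprec (fo F) y = fprec F y.
Proof. by rewrite /hprec linextU. Qed.

Lemma hprec1 y : hprec 1 y = 0.
Proof. by rewrite -forest_nil hprec_forest. Qed.

Lemma hprec_cons d G F y : hprec (fo (PNode d G :: F)) y
  = fo [:: PNode d G] * hprec (fo F) y
    + Bplus d (fo G * (fo F * y - hprec (fo F) y)).
Proof. by rewrite !hprec_forest. Qed.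

Lemma counit_hprec x y : counit (hprec x y) = 0.
Proof. by have /eqP := hprec_in_ker x y. Qed.

Definition coprod_trunk : HD -> (HD \ox HD)%type :=
  linext (fun F : {fmonom (ptree D)} =>
    forest_trunk hmul 1 (@forest K D) (@coprod K D)
      (tree_trunk hmul 1 (@forest K D) (@Bplus K D) (@coprod K D)) F).

HB.instance Definition _ :=
  GRing.isLinear.Build K HD (HD \ox HD)%type *:%R coprod_trunk
    (linext_is_linear _).

Lemma coprod_trunk_forest F : coprod_trunk (fo F)
  = forest_trunk hmul 1 (@forest K D) (@coprod K D)
      (tree_trunk hmul 1 (@forest K D) (@Bplus K D) (@coprod K D)) F.
Proof. by rewrite /coprod_trunk linextU. Qed.

Lemma proj_bullet d : proj (Bplus d 1) = bullet K d.
Proof.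
apply: val_inj; rewrite /= (eqP (Bplus_in_ker d 1)).
by rewrite scale0r subr0.
Qed.

Fact of_unitization_linear : linear (@of_unitization K D).
Proof.
move=> c x y; rewrite /of_unitization /= scalerDl scalerDr addrACA.
by rewrite scalerA.
Qed.

HB.instance Definition _ := GRing.isLinear.Build K (unitization AD) HD *:%R
  (@of_unitization K D) of_unitization_linear.

Fact uincl_linear : linear (@uincl K AD).
Proof.
by move=> c x y; rewrite /uincl; congr (_, _); rewrite /= scaler0 addr0.
Qed.

HB.instance Definition _ := GRing.isLinear.Build K AD (unitization AD) *:%R
  (@uincl K AD) uincl_linear.

Lemma of_unitization_one : of_unitization (uone AD) = 1.
Proof. by rewrite /of_unitization /= add0r scale1r. Qed.

Lemma of_unitization_incl (v : AD) : of_unitization (uincl v) = adval v.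
Proof. by rewrite /of_unitization /= scale0r addr0. Qed.

Lemma counit_of_unitization (v : AD) (k : K) :
  counit (of_unitization (v, k)) = k.
Proof.
rewrite /of_unitization addrC counitP counit1 mulr1 /=.
by case: v => v /= /eqP ->; rewrite addr0.
Qed.

(** Only the sum of the half coproducts and the sum of the half products enter
    the induced bialgebra. *)
Lemma induces_forest_bialgebra_of_split (prec succ : AD -> AD -> AD) Dp Ds :
    (forall v w, adval (prec v w + succ v w) = adval v * adval w) ->
    splits_reduced_coprod Dp Ds ->
  induces_forest_bialgebra prec succ Dp Ds.
Proof.
move=> muls splits; split.
- exists (fun x => (proj x, counit x : K^o)) => [[v k]|x].
    congr (_, _); last exact: counit_of_unitization.
    apply: val_inj; rewrite /= counit_of_unitization.
    by rewrite /of_unitization addrK.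
  by rewrite /of_unitization /= subrK.
- exact: of_unitization_linear.
- exact: of_unitization_one.
- move=> [v k] [w l].
  transitivity (adval v * adval w + l *: adval v + k *: adval w
    + (k * l) *: (1 : HD)).
    by rewrite -(muls v w).
  rewrite /of_unitization /= mulrDl !mulrDr -!scalerAl mul1r !hmul_scaler.
  rewrite !mulr1 scalerA; exact: esym (addrA _ _ _).
- move=> [v k]; rewrite -[tmap _ _ _]tensmap_sweedler /ucoprod /= -!tenE.
  rewrite !tensmapD tensmapZ !tensmapE /=.
  rewrite of_unitization_one of_unitization_incl -[tmap _ _ _]tensmap_sweedler.
  rewrite (tensmap_comp (f'' := @adval K D) (g'' := @adval K D));
    try exact: of_unitization_incl.
  have -> : tensmap (@adval K D) (@adval K D) (Dp v + Ds v)
      = coprod (adval v) - adval v \ot 1 - 1 \ot adval v.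
    by rewrite tensmap_sweedler !tenE; apply: splits.
  have -> : coprod (of_unitization (v, k))
      = coprod (adval v) + (k : K) *: (1 \ot 1).
    rewrite [of_unitization _]addrC linearP addrC /=; congr (_ + _ *: _).
    by rewrite -forest_nil coprod_forest /= big_seq1.
  exact: addr_unit_part.
- by move=> [v k]; apply: counit_of_unitization.
Qed.

End ForestAlgebra.

Theorem theorem31 (K : fieldType) (D : choiceType) (hD : inhabited D)
    (prec succ : AD K D -> AD K D -> AD K D)
    (hps : tree_dendriform prec succ) :
  exists Dp Ds : AD K D -> (AD K D \ox AD K D)%type,
    [/\ tree_bidendriform prec succ Dp Ds,
        (forall Dp' Ds' : AD K D -> (AD K D \ox AD K D)%type,
           tree_bidendriform prec succ Dp' Ds' -> Dp' =1 Dp /\ Ds' =1 Ds)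
      & induces_forest_bialgebra prec succ Dp Ds].
Proof.
case: hps => dend muls bullets.
pose B : D -> {linear forest_algebra K D -> forest_algebra K D} :=
  fun d => @Bplus K D d.
have bulE d : bul 1 B (@proj K D) d = bullet K d by apply: proj_bullet.
have bulP d v : adval (prec (bul 1 B (@proj K D) d) v) = B d (adval v).
  by rewrite bulE; apply: bullets.
have [Dp [Ds [bb red b0 uniq]]] := forest_bidendriform
  (mul := hmul (D := D)) (B := B)
  (prec := hprec (D := D)) (iota := adval (D := D))
  (@forest_span_ind K D) (forest_nil K D) (@forest_cat K D)
  (@Bplus_forest K D) (@mulrA _) (@mul1r _) (@mulr1 _) (@coprod_forest K D)
  (@counitP K D) (@counit_forest K D) (@adval_proj K D) (@advalK K D)
  (@hprec1 K D) (@hprec_cons K D) (@hprec_mul K D) (@counit_hprec K D)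
  (@coprod_trunk_forest K D) dend muls bulP.
have split_red : splits_reduced_coprod Dp Ds.
  by move=> v; have := red v; rewrite tensmap_sweedler !tenE.
exists Dp, Ds; split.
- by split=> // d; rewrite -bulE; case: (b0 d).
- move=> Dp' Ds' [_ bb' bp' bs']; apply: uniq => // d.
  by rewrite bulE bp' bs'.
- exact: induces_forest_bialgebra_of_split.
Qed.
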